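(* Let $d\ge 1$ be an integer and let $\alpha_1,\dots,\alpha_d$ be real numbers with $\alpha_i>-1$ for all $i\in\{1,2,\dots,d\}$. Then the radius of convexity $r^{c}(f_{\alpha})$ of the normalized hyper-Bessel function $f_{\alpha}(z)=z\mathcal{J}_{\alpha}(z)$ is the smallest positive root of the equation $$\mathcal{J}_{\alpha}(z)+3z\mathcal{J}_{\alpha}'(z)+z^2\mathcal{J}_{\alpha}''(z)=0,$$ and it satisfies $$\frac{(d+1)^{d+1}A(\alpha)}{(d+2)^2}<\left(r^{c}(f_{\alpha})\right)^{d+1}<\frac{(d+1)^{d+1}(d+2)^2A(\alpha)B(\alpha)}{(d+2)^{4}B(\alpha)-(2d+3)^2A(\alpha)}.$$
   Context: Write $\alpha=(\alpha_1,\dots,\alpha_d)$. The normalized hyper-Bessel function is the entire function $$\mathcal{J}_{\alpha}(z)=\sum_{n\ge 0}\frac{(-1)^n}{n!\,(\alpha_1+1)_n\cdots(\alpha_d+1)_n}\left(\frac{z}{d+1}\right)^{n(d+1)},$$ where $(\beta)_0=1$ and $(\beta)_n=\beta(\beta+1)\cdots(\beta+n-1)$ for $n\ge1$. Set $f_{\alpha}(z)=z\mathcal{J}_{\alpha}(z)$, $A(\alpha)=\prod_{i=1}^d(\alpha_i+1)$ and $B(\alpha)=\prod_{i=1}^d(\alpha_i+2)$. For an analytic function $f$ with $f'(0)\neq 0$, the radius of convexity is $$r^{c}(f)=\sup\left\{r>0:\ \operatorname{Re}\left(1+\frac{zf''(z)}{f'(z)}\right)>0\ \text{for all } z\in\mathbb{D}_r\right\},\qquad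 \mathbb{D}_r=\{z\in\mathbb{C}:|z|<r\},$$ where the condition requires $f'(z)\ne0$ on $\mathbb{D}_r$. *)

(* Defs.v *)
From HB Require Import structures.
From mathcomp Require Import all_boot all_order all_algebra.
From mathcomp Require Import complex.
From mathcomp Require Import boolp classical_sets reals ereal topology normedtype.
From mathcomp Require Import sequences derive.

Set Implicit Arguments.
Unset Strict Implicit.
Unset Printing Implicit Defensive.

Import Order.TTheory GRing.Theory Num.Theory.
Import numFieldNormedType.Exports.

Local Open Scope complex_scope.
Local Open Scope ring_scope.
Local Open Scope classical_set_scope.

(* Typing the complex numbers as a numClosedFieldType, rather than as the bare
   type R[i], gives them the topology and normed-module structure induced by
   the modulus, so that limn and derive1 below are the complex limit and the
   complex derivative. *)
Definition Cplx (R : realType) : numClosedFieldType := R[i].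

Definition rising_factorial (R : realType) (b : R) (n : nat) : R :=
  \prod_(k < n) (b + k%:R).

Definition hyper_bessel_term (R : realType) (d : nat) (alpha : 'I_d -> R)
    (z : Cplx R) (n : nat) : Cplx R :=
  ((-1) ^+ n /
     (n`!%:R * \prod_(i < d) rising_factorial (alpha i + 1) n))%:C
  * (z / d.+1%:R) ^+ (n * d.+1).

Definition hyper_bessel (R : realType) (d : nat) (alpha : 'I_d -> R)
    (z : Cplx R) : Cplx R :=
  limn (series (hyper_bessel_term alpha z)).

Definition hyper_bessel_f (R : realType) (d : nat) (alpha : 'I_d -> R)
    (z : Cplx R) : Cplx R :=
  z * hyper_bessel alpha z.

Definition convex_on_disk (R : realType) (f : Cplx R -> Cplx R) (r : R) : Prop :=
  forall z : Cplx R, `|z| < (r%:C : Cplx R) ->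
    derive1 f z != 0 /\
    0 < complex.Re (1 + z * derive1 (derive1 f) z / derive1 f z).

(* The supremum is taken in the extended reals, so that an unbounded set of
   radii gives +oo. *)
Definition radius_of_convexity (R : realType) (f : Cplx R -> Cplx R) : \bar R :=
  ereal_sup [set r%:E | r in [set r : R | 0 < r /\ convex_on_disk f r]].

Definition is_smallest_positive_root (R : realType) (F : Cplx R -> Cplx R)
    (r : R) : Prop :=
  [/\ 0 < r, F r%:C = 0 & forall s : R, 0 < s -> F s%:C = 0 -> r <= s].

Definition prodA (R : realType) (d : nat) (alpha : 'I_d -> R) : R :=
  \prod_(i < d) (alpha i + 1).

Definition prodB (R : realType) (d : nat) (alpha : 'I_d -> R) : R :=
  \prod_(i < d) (alpha i + 2%:R).

(* Main.v *)
(* With w = (z/(d+1))^(d+1), the functions f' and h = (z f')' are power series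
   in w with coefficients (1+(d+1)n)^k (-1)^n / (n! prod_i (alpha_i+1)_n), for
   k = 1, 2, and 1 + z f''/f' = h/f'.  Such a series is a coefficientwise limit
   of polynomials with only positive zeros: start from (1 - w/N)^N, note that
   p |-> p + w p'/b preserves positive zeros for b > 0, and obtain division by
   (alpha+1)_n as a Gauss limit of such multipliers.  No factorization theorem
   is used: for a series a with a_0 = 1 let sigma_m be the coefficients of
   -w a'/a, the limits of the power sums of the reciprocal zeros of the
   polynomials.  They are nonnegative, log-convex and submultiplicative, so
   sigma_(m+1)/sigma_m increases to some r with
   r^m <= sigma_m <= sigma_1 r^(m-1).  Consequently 1/a converges for |w| < 1/r,
   a(1/r) = 0, and sigma_2/sigma_1 < r <= sqrt(sigma_2) < sigma_1, which for h is
   the announced pair of bounds.  Finally h/f' = 1 - (d+1) sum_m sigma_m w^m has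
   real part at least its value at |w|, so it stays positive up to the first
   positive zero of h. *)
Require Import Defs.
From HB Require Import structures.
From mathcomp Require Import all_boot all_order all_algebra.
From mathcomp Require Import complex.
From mathcomp Require Import boolp classical_sets reals ereal topology normedtype.
From mathcomp Require Import functions sequences derive.
From mathcomp Require Import ring lra zify.

Import Order.TTheory GRing.Theory Num.Theory.
Import numFieldNormedType.Exports.

Local Open Scope complex_scope.
Local Open Scope ring_scope.
Local Open Scope classical_set_scope.

Set Implicit Arguments.
Unset Strict Implicit.
Unset Printing Implicit Defensive.

(** * Complex sequences and power series *)

(** The norm of [Cplx R] has values in [Cplx R] itself; its real part can be compared with real
    sequences. *)
Definition cmod (R : realType) (z : Cplx R) : R := complex.Re `|z|.

Section ComplexSequences.
Variable R : realType.
Local Notation C := (Cplx R).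
Implicit Types (z w : C) (u : nat -> C).

Lemma cmodE z : `|z| = (cmod z)%:C :> C.
Proof. by rewrite /cmod normc_def. Qed.

Lemma cmod_ge0 z : 0 <= cmod z.
Proof. by rewrite -ler0c -cmodE normr_ge0. Qed.

Lemma cmodM z w : cmod (z * w) = cmod z * cmod w.
Proof. by apply: complexI; rewrite rmorphM /= -!cmodE normrM. Qed.

Lemma cmodX z n : cmod (z ^+ n) = cmod z ^+ n.
Proof. by apply: complexI; rewrite rmorphXn /= -!cmodE normrX. Qed.

Lemma cmodD z w : cmod (z + w) <= cmod z + cmod w.
Proof. by rewrite -lecR rmorphD /= -!cmodE ler_normD. Qed.

Lemma cmod_real (x : R) : cmod x%:C = `|x|.
Proof. by rewrite /cmod normc_def /= expr0n addr0 sqrtr_sqr. Qed.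

Lemma cmod_sum (I : Type) (r : seq I) (P : pred I) (F : I -> C) :
  cmod (\sum_(i <- r | P i) F i) <= \sum_(i <- r | P i) cmod (F i).
Proof.
rewrite -lecR rmorph_sum /= -cmodE; apply: le_trans (ler_norm_sum _ _ _) _.
by apply: ler_sum => i _; rewrite cmodE.
Qed.

Lemma Re_le_cmod z : `|complex.Re z| <= cmod z.
Proof.
by rewrite /cmod normc_def /= -sqrtr_sqr ler_wsqrtr // lerDl sqr_ge0.
Qed.

Lemma Im_le_cmod z : `|complex.Im z| <= cmod z.
Proof.
by rewrite /cmod normc_def /= -sqrtr_sqr ler_wsqrtr // lerDr sqr_ge0.
Qed.

Lemma cmod_le_ReIm z : cmod z <= `|complex.Re z| + `|complex.Im z|.
Proof.
rewrite {1}[z]complexE; apply: le_trans (cmodD _ _) _.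
by rewrite cmodM !cmod_real /cmod normc_def /= expr0n expr1n add0r sqrtr1 mul1r.
Qed.

(** Positive elements of [Cplx R] are real, so real epsilons suffice for the complex topology. *)
Lemma cvg_cmod u (l : C) :
  (fun n => cmod (l - u n)) @ \oo --> (0 : R) <-> u @ \oo --> l.
Proof.
split => [/cvgrPdist_lt H|/cvgrPdist_lt H]; apply/cvgrPdist_lt.
  move=> e e0; have eE : e = (complex.Re e)%:C by rewrite RRe_real ?gtr0_real.
  have e0' : 0 < complex.Re e by rewrite -ltcR -eE.
  have := H _ e0'; apply: filterS => n; rewrite sub0r normrN ger0_norm ?cmod_ge0 //.
  by rewrite -ltcR -cmodE -eE.
move=> e e0; have e0' : 0 < e%:C :> C by rewrite ltcR.
have := H _ e0'; apply: filterS => n h; rewrite sub0r normrN ger0_norm ?cmod_ge0 //.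
by rewrite -ltcR -cmodE.
Qed.

Lemma cvg_ReIm u (a b : R) :
  (fun n => complex.Re (u n)) @ \oo --> a ->
  (fun n => complex.Im (u n)) @ \oo --> b -> u @ \oo --> (a +i* b : C).
Proof.
move=> ha hb; apply/cvg_cmod.
apply: (@squeeze_cvgr _ _ _ _ (fun=> 0)
   (fun n => `|a - complex.Re (u n)| + `|b - complex.Im (u n)|)).
- apply: nearW => n; rewrite cmod_ge0 /=; apply: le_trans (cmod_le_ReIm _) _.
  by case: (u n).
- exact: cvg_cst.
- rewrite -(addr0 0); apply: cvgD.
    rewrite -(normr0 R) -(subrr a); apply: cvg_norm; apply: cvgB => //; exact: cvg_cst.
  rewrite -(normr0 R) -(subrr b); apply: cvg_norm; apply: cvgB => //; exact: cvg_cst.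
Qed.

Lemma cvg_real_complex (x : nat -> R) (l : R) :
  x @ \oo --> l -> (fun n => (x n)%:C : C) @ \oo --> (l%:C : C).
Proof. by move=> h; apply: cvg_ReIm => //=; exact: cvg_cst. Qed.

Lemma cvg_Re u (l : C) :
  u @ \oo --> l -> (fun n => complex.Re (u n)) @ \oo --> complex.Re l.
Proof.
move=> /cvg_cmod h; apply/cvgrPdist_lt => e e0; move/cvgrPdist_lt: h => /(_ _ e0).
apply: filterS => n; rewrite sub0r normrN ger0_norm ?cmod_ge0 // => h.
by apply: le_lt_trans h; have := Re_le_cmod (l - u n); case: (l) => a b; case: (u n).
Qed.

Lemma cvgC_unique u (l l' : C) : u @ \oo --> l -> u @ \oo --> l' -> l = l'.
Proof. by apply: cvg_unique; exact: norm_hausdorff. Qed.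

Lemma limC_eq u (l : C) : u @ \oo --> l -> limn u = l.
Proof. by apply: cvg_lim; exact: norm_hausdorff. Qed.

Lemma cvg_cmodD u (l : C) : u @ \oo --> l -> (fun n => cmod (u n)) @ \oo --> cmod l.
Proof. by move=> h; apply: (@cvg_Re (fun n => `|u n|)); apply: cvg_norm. Qed.

(** Weierstrass comparison: real and imaginary parts are each dominated by [v], hence converge
    absolutely in [R]. *)
Lemma series_dominated u (v : nat -> R) :
  (forall n, cmod (u n) <= v n) -> cvgn (series v) ->
  cvgn (series u) /\ cmod (limn (series u)) <= limn (series v).
Proof.
move=> uv cv.
have H (f : C -> R) : (forall x, `|f x| <= cmod x) -> {morph f : x y / x + y} -> f 0 = 0 ->
   (fun n => f (series u n)) @ \oo --> limn (series (fun n => f (u n))).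
  move=> fle fD f0; have -> : (fun n => f (series u n)) = series (fun n => f (u n)).
    by apply/funext => n; rewrite /series /= (big_morph f fD f0).
  apply: normed_cvg; apply: series_le_cvg cv => [n|n|n].
  - exact: normr_ge0.
  - exact: le_trans (cmod_ge0 _) (uv n).
  - exact: le_trans (fle _) (uv n).
have hR : (fun n => complex.Re (series u n)) @ \oo --> limn (series (fun n => complex.Re (u n))).
  by apply: H => //; [exact: Re_le_cmod|case=> a b []].
have hI : (fun n => complex.Im (series u n)) @ \oo --> limn (series (fun n => complex.Im (u n))).
  by apply: H => //; [exact: Im_le_cmod|case=> a b []].
have cu := cvg_ReIm hR hI.
have cu' : cvgn (series u) by apply/cvg_ex; eexists; exact: cu.
split=> //; have := cvg_cmodD cu'; move=> cm.
rewrite -(cvg_lim (@Rhausdorff R) cm); apply: ler_lim => //.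
  by apply/cvg_ex; eexists; exact: cm.
apply: nearW => n; rewrite /series /=; apply: le_trans (cmod_sum _ _ _) _.
exact: ler_sum.
Qed.

End ComplexSequences.

Lemma cvg_ext (T : topologicalType) (f g : nat -> T) (l : T) :
  f =1 g -> f @ \oo --> l -> g @ \oo --> l.
Proof. by move=> /funext ->. Qed.

(** * Cauchy products *)

Definition conv (K : pzSemiRingType) (a b : nat -> K) (n : nat) : K :=
  \sum_(k < n.+1) a k * b (n - k)%N.

Section Convolution.
Variable R : realType.
Local Notation C := (Cplx R).

(** Cut the sum at a [J] beyond which the tail of [series v] is small. Above the cut [u] is merely
    bounded; below it the index [n - k] is large, so [u] is small. *)
Lemma conv_cvg0 (v u : nat -> R) :
  (forall n, 0 <= v n) -> (forall n, 0 <= u n) ->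
  cvgn (series v) -> u @ \oo --> (0 : R) -> conv v u @ \oo --> (0 : R).
Proof.
move=> v0 u0 cv cu.
have sv_le n : series v n <= limn (series v).
  by apply: nondecreasing_cvgn_le => //; apply/nondecreasing_seqP => m;
     rewrite /series /= big_nat_recr //= lerDl.
set V := limn (series v) in sv_le *.
have V0 : 0 <= V by have := sv_le 0%N; rewrite /series /= big_geq.
have [B B0 uB] : exists2 B, 0 < B & forall n, u n <= B.
  have /cvg_seq_bounded [B [_ HB]] : cvgn u by apply/cvg_ex; exists 0.
  exists (`|B| + 1); first by rewrite ltr_wpDl.
  move=> n; rewrite -[u n]ger0_norm //; apply: HB => //.
  by rewrite (le_lt_trans (ler_norm _)) // ltrDl.
apply/cvgrPdist_le => e e0.
have e1 : 0 < e / (2 * B) by rewrite divr_gt0 // mulr_gt0.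
have e2 : 0 < e / (2 * (V + 1)) by rewrite divr_gt0 // mulr_gt0 // ltr_wpDl.
have [J _ HJ] : \forall n \near \oo, `|V - series v n| < e / (2 * B).
  by move/cvgrPdist_lt: cv; exact.
have [M _ HM] : \forall n \near \oo, `|0 - u n| < e / (2 * (V + 1)).
  by move/cvgrPdist_lt: cu; exact.
exists (J + M)%N => // n /= Hn.
have conv0 : 0 <= conv v u n by apply: sumr_ge0 => k _; rewrite mulr_ge0.
rewrite sub0r normrN ger0_norm // /conv.
rewrite -(big_mkord xpredT (fun k => v k * u (n - k)%N)).
rewrite (big_cat_nat (n := J)) //=; last by lia.
have S1 : \sum_(0 <= k < J) v k * u (n - k)%N <= e / 2.
  apply: (@le_trans _ _ (V * (e / (2 * (V + 1))))); last first.
    have V1 : V + 1 != 0 by rewrite gt_eqF // ltr_wpDl.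
    have -> : V * (e / (2 * (V + 1))) = (e / 2) * (V / (V + 1)) by field.
    rewrite ler_piMr ?divr_ge0 // ?(ltW e0) //.
    by rewrite ler_pdivrMr ?mul1r ?ltr_wpDl // lerDl.
  apply: (@le_trans _ _ (series v J * (e / (2 * (V + 1))))); last first.
    by rewrite ler_wpM2r // ltW.
  rewrite /series /= mulr_suml; apply: ler_sum_nat => k /andP[_ kJ].
  rewrite ler_wpM2l //; have := HM (n - k)%N; rewrite /= sub0r normrN ger0_norm //.
  by move=> H; apply/ltW/H; lia.
have S2 : \sum_(J <= k < n.+1) v k * u (n - k)%N <= e / 2.
  apply: (@le_trans _ _ ((V - series v J) * B)).
    apply: (@le_trans _ _ ((series v n.+1 - series v J) * B)); last first.
      by rewrite (ler_wpM2r (ltW B0)) // lerD2r.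
    rewrite sub_series_geq; last by lia.
    by rewrite mulr_suml; apply: ler_sum => k _; rewrite ler_wpM2l.
  have := HJ J (leqnn _); rewrite ger0_norm ?subr_ge0 // => /ltW H.
  apply: le_trans (ler_wpM2r (ltW B0) H) _.
  have -> : e / (2 * B) * B = e / 2 by field; rewrite gt_eqF.
  by [].
lra.
Qed.

(** Subtracting [l] from [s] reduces this to [conv_cvg0]. With partial sums for [s] it is Mertens'
    theorem; with normalised power sums for [s] it locates a zero of the series. *)
Lemma conv_cvg (t s : nat -> C) (l : C) :
  cvgn (series (fun n => cmod (t n))) -> s @ \oo --> l ->
  conv t s @ \oo --> limn (series t) * l.
Proof.
move=> ct cs.
have [ct' _] := series_dominated (fun n => lexx (cmod (t n))) ct.
have c1 : (fun n => series t n.+1 * l) @ \oo --> limn (series t) * l.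
  apply: cvgM; last exact: cvg_cst.
  by have := ct'; rewrite -(cvg_shiftS (series t)).
have c0 : (fun n => conv t s n - series t n.+1 * l) @ \oo --> (0 : C).
  apply/cvg_cmod; apply: (@squeeze_cvgr _ _ _ _ (fun=> 0)
     (conv (fun n => cmod (t n)) (fun n => cmod (l - s n)))).
  - apply: nearW => n; rewrite cmod_ge0 /= sub0r.
    have -> : - (conv t s n - series t n.+1 * l) =
       \sum_(k < n.+1) t k * (l - s (n - k)%N).
      rewrite opprB /series /= big_mkord mulr_suml /conv -sumrB.
      by apply: eq_bigr => k _; rewrite mulrBr.
    apply: le_trans (cmod_sum _ _ _) _; apply: ler_sum => k _.
    by rewrite cmodM.
  - exact: cvg_cst.
  - apply: conv_cvg0 => //; try by move=> n; exact: cmod_ge0.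
    exact/cvg_cmod.
have := cvgD c0 c1; rewrite add0r => H; apply: (cvg_ext _ (H _)) => n; exact: subrK.
Qed.

Lemma series_conv (a b : nat -> C) n :
  series (conv a b) n.+1 = conv a (fun m => series b m.+1) n.
Proof.
elim: n => [|n IH].
  by rewrite /series /= /conv !big_nat1 !big_ord1 !subnn big_nat1.
rewrite seriesSr IH.
rewrite /conv [RHS]big_ord_recr [X in _ + X]big_ord_recr /= addrA subnn.
congr (_ + _); last by rewrite /series /= big_nat1.
rewrite -big_split /=; apply: eq_bigr => k _; rewrite -mulrDr; congr (_ * _).
rewrite subSn; last by rewrite -ltnS.
by rewrite [RHS]seriesSr.
Qed.

End Convolution.

(** * Power series with real coefficients at complex points *)

Definition pser (R : realType) (a : nat -> R) (z : Cplx R) : Cplx R :=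
  limn (series (fun n => (a n)%:C * z ^+ n : Cplx R)).

Definition abscv (R : realType) (a : nat -> R) (x : R) : Prop :=
  cvgn (series (fun n => `|a n| * x ^+ n)).

Section PowerSeries.
Variable R : realType.
Local Notation C := (Cplx R).
Implicit Types (a b : nat -> R) (z : C) (x y : R).

(** Abel's lemma: a bound at [y] yields a geometric majorant of ratio [x / y]. *)
Lemma abscv_bounded a x y (K : R) : 0 <= x < y ->
  (forall n, `|a n| * y ^+ n <= K) -> abscv a x.
Proof.
move=> /andP[x0 xy] aK; have y0 : 0 < y by exact: le_lt_trans xy.
apply: (@series_le_cvg _ _ (geometric K (x / y))).
- by move=> n; rewrite mulr_ge0 // exprn_ge0.
- by move=> n; rewrite /= mulr_ge0 // ?exprn_ge0 ?divr_ge0 ?(ltW y0) //;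
    apply: le_trans (aK 0%N); rewrite mulr_ge0 // exprn_ge0 ?ltW.
- move=> n; rewrite /= expr_div_n mulrA ler_pdivlMr ?exprn_gt0 //.
  by rewrite mulrAC ler_wpM2r // exprn_ge0.
- apply: is_cvg_geometric_series.
  by rewrite ger0_norm ?divr_ge0 ?(ltW y0) // ltr_pdivrMr // mul1r.
Qed.

Lemma cmod_term a z n : cmod ((a n)%:C * z ^+ n) = `|a n| * cmod z ^+ n.
Proof. by rewrite cmodM cmod_real cmodX. Qed.

Lemma pser_cvg a z : abscv a (cmod z) ->
  series (fun n => (a n)%:C * z ^+ n : Cplx R) @ \oo --> pser a z.
Proof.
by case/(@series_dominated R (fun n => (a n)%:C * z ^+ n : Cplx R)) => // n; rewrite cmod_term.
Qed.

Lemma cmod_pser a z : abscv a (cmod z) ->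
  cmod (pser a z) <= limn (series (fun n => `|a n| * cmod z ^+ n)).
Proof.
by case/(@series_dominated R (fun n => (a n)%:C * z ^+ n : Cplx R)) => // n; rewrite cmod_term.
Qed.

Lemma pserM a b z : abscv a (cmod z) -> abscv b (cmod z) ->
  pser (conv a b) z = pser a z * pser b z.
Proof.
move=> ca cb; apply: limC_eq; rewrite -cvg_shiftS.
set ta := fun n => (a n)%:C * z ^+ n : Cplx R; set tb := fun n => (b n)%:C * z ^+ n : Cplx R.
have -> : (fun n => series (fun n => (conv a b n)%:C * z ^+ n : Cplx R) n.+1) =
   conv ta (fun m => series tb m.+1).
  apply/funext => n; rewrite -series_conv; congr (series _ _); apply/funext => m.
  rewrite /conv rmorph_sum /= mulr_suml; apply: eq_bigr => k _.
  rewrite /ta /tb rmorphM /= mulrACA -exprD subnKC //.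
  by rewrite -ltnS.
apply: conv_cvg.
  by have := ca; rewrite /abscv; under eq_fun do rewrite -cmod_term.
by rewrite (cvg_shiftS (series tb)); exact: pser_cvg.
Qed.

Lemma pserD a b z : abscv a (cmod z) -> abscv b (cmod z) ->
  pser (fun n => a n + b n) z = pser a z + pser b z.
Proof.
move=> /pser_cvg ca /pser_cvg cb; apply: limC_eq; have H := cvgD ca cb.
apply: (cvg_ext _ (H _)) => N; rewrite fctE /series /= -big_split /=.
by apply: eq_bigr => n _; rewrite rmorphD mulrDl.
Qed.

Lemma pserZ a (k : R) z : abscv a (cmod z) ->
  pser (fun n => k * a n) z = k%:C * pser a z.
Proof.
move=> /pser_cvg ca; apply: limC_eq.
have H : (fun N => (k%:C : C) * series (fun n => (a n)%:C * z ^+ n : C) N) @ \oo --> ((k%:C : C) * pser a z).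
  by apply: cvgM ca; exact: cvg_cst.
apply: (cvg_ext _ H) => N; rewrite /series /= mulr_sumr.
by apply: eq_bigr => n _; rewrite rmorphM mulrA.
Qed.

Lemma pser_shift a z : abscv (fun n => a n.+1) (cmod z) ->
  pser a z = (a 0%N)%:C + z * pser (fun n => a n.+1) z.
Proof.
move=> /pser_cvg ca; apply: limC_eq; rewrite -cvg_shiftS.
have H : (fun N => ((a 0%N)%:C : C) + z * series (fun n => (a n.+1)%:C * z ^+ n : C) N) @ \oo
    --> ((a 0%N)%:C : C) + z * pser (fun n => a n.+1) z.
  by apply: cvgD; [exact: cvg_cst|apply: cvgM ca; exact: cvg_cst].
apply: (cvg_ext _ H) => N; rewrite /series /= mulr_sumr.
rewrite [RHS]big_nat_recl //= expr0 mulr1; congr (_ + _).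
by apply: eq_bigr => n _; rewrite exprS mulrCA.
Qed.

Lemma pser_real a x : 0 <= x -> abscv a x ->
  pser a x%:C = (limn (series (fun n => a n * x ^+ n)))%:C.
Proof.
move=> x0 ca; apply: limC_eq.
have /(@cvg_real_complex R) H : cvgn (series (fun n => a n * x ^+ n)).
  apply: normed_cvg; rewrite /normed_series_of /=.
  by have := ca; rewrite /abscv; under eq_fun do rewrite -{1}(ger0_norm x0) -normrX -normrM.
apply: (cvg_ext _ H) => N; rewrite /series /= rmorph_sum /=.
by apply: eq_bigr => n _; rewrite rmorphM rmorphXn.
Qed.

Lemma pser1 z : pser (fun n => (n == 0%N)%:R) z = 1.
Proof.
apply: limC_eq; rewrite -cvg_shiftS.
have H : (fun=> 1 : C) @ \oo --> (1 : C) by exact: cvg_cst.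
apply: (cvg_ext _ H) => N; rewrite /series /= big_nat_recl //= mulr1 big1 ?addr0 //.
by move=> i _; rewrite mul0r.
Qed.

End PowerSeries.

(** * Entire power series: stability, substitution, termwise differentiation *)

Lemma cvg_succ (T : ptopologicalType) (f : nat -> T) (l : T) :
  f @ \oo --> l -> (fun n => f n.+1) @ \oo --> l.
Proof. by rewrite -(cvg_shiftS f). Qed.

Lemma cvg_multiples (T : topologicalType) (f : nat -> T) (l : T) (D : nat) :
  (0 < D)%N -> f @ \oo --> l -> (fun n => f (n * D)%N) @ \oo --> l.
Proof.
move=> D0 fl; apply: (@cvg_comp _ _ _ (fun n => (n * D)%N) f \oo \oo); last exact: fl.
by move=> A [N _ HN]; exists N => // n /= Nn; apply: HN => /=; nia.
Qed.

(** By [abscv_bounded] this amounts to an infinite radius of convergence; bounds are easier to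
    propagate than sums. *)
Definition entire (R : realType) (a : nat -> R) : Prop :=
  forall y : R, 0 <= y -> exists K, forall n, `|a n| * y ^+ n <= K.

Definition diffs (R : realType) (a : nat -> R) (n : nat) : R := n.+1%:R * a n.+1.

(** Coefficients in [z] of the series [a] taken at [(c * z) ^+ D]. *)
Definition spread (R : realType) (D : nat) (c : R) (a : nat -> R) (k : nat) : R :=
  if (D %| k)%N then a (k %/ D)%N * c ^+ k else 0.

Section EntireSeries.
Variable R : realType.
Local Notation C := (Cplx R).
Implicit Types (a b : nat -> R) (z : C) (x y : R).

Lemma entire_abscv a x : 0 <= x -> entire a -> abscv a x.
Proof.
move=> x0 /(_ (x + 1) (addr_ge0 x0 ler01)) [K HK].
by apply: (@abscv_bounded _ a x (x + 1) K) => //; rewrite x0 ltrDl ltr01.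
Qed.

Lemma entire_cmod a z : entire a -> abscv a (cmod z).
Proof. exact/entire_abscv/cmod_ge0. Qed.

Lemma natr_le_exp2 n : n%:R <= (2 : R) ^+ n.
Proof. by rewrite -natrX ler_nat ltnW // ltn_expl. Qed.

(** Doubling the radius absorbs the factor, since [n <= 2 ^+ n]. *)
Lemma entire_natM a : entire a -> entire (fun n => n%:R * a n).
Proof.
move=> ea y y0; have [K HK] := ea (2 * y) (mulr_ge0 (ler0n _ 2) y0).
exists K => n; apply: le_trans (HK n).
rewrite normrM normr_nat exprMn; have np := natr_le_exp2 n.
have h : 0 <= `|a n| * y ^+ n by rewrite mulr_ge0 // exprn_ge0.
by rewrite mulrCA -mulrA ler_wpM2r.
Qed.

Lemma entire_shift a : entire a -> entire (fun n => a n.+1).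
Proof.
move=> ea y y0; have [K HK] := ea (y + 1) (addr_ge0 y0 ler01).
exists K => n; apply: le_trans (HK n.+1); rewrite ler_wpM2l //.
apply: (@le_trans _ _ ((y + 1) ^+ n)).
  by rewrite lerXn2r ?nnegrE ?addr_ge0 // lerDl.
by rewrite ler_weXn2l // lerDr.
Qed.

Lemma entire_diffs a : entire a -> entire (diffs a).
Proof. by move/entire_natM/entire_shift. Qed.

Lemma entireD a b : entire a -> entire b -> entire (fun n => a n + b n).
Proof.
move=> ea eb y y0; have [K HK] := ea y y0; have [L HL] := eb y y0.
exists (K + L) => n; apply: le_trans (lerD (HK n) (HL n)).
by rewrite -mulrDl ler_wpM2r ?exprn_ge0 // ler_normD.
Qed.

Lemma entireZ (k : R) a : entire a -> entire (fun n => k * a n).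
Proof.
move=> ea y y0; have [K HK] := ea y y0; exists (`|k| * K) => n.
by rewrite normrM -mulrA ler_wpM2l.
Qed.

Lemma entire_spread D (c : R) a : entire a -> entire (spread D c a).
Proof.
move=> ea y y0; have [K HK] := ea ((`|c| * y) ^+ D) (exprn_ge0 _ (mulr_ge0 (normr_ge0 _) y0)).
exists K => k; rewrite /spread; case: ifP => [Dk|_]; last first.
  by rewrite normr0 mul0r; apply: le_trans (HK 0%N); rewrite mulr_ge0.
apply: le_trans (HK (k %/ D)%N); rewrite -exprM mulnC divnK //.
by rewrite normrM normrX exprMn mulrA.
Qed.

Lemma pser_spread D (c : R) a z : (0 < D)%N -> entire a ->
  pser (spread D c a) z = pser a ((c%:C * z) ^+ D).
Proof.
move=> D0 ea; have es := entire_spread D c ea.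
have := pser_cvg (entire_cmod (z:=z) es); have := pser_cvg (entire_cmod (z:=(c%:C * z) ^+ D) ea).
set u : nat -> C := (X in series X @ _ --> _ -> _) => hu.
set v : nat -> C := (X in series X @ _ --> _ -> _) => hv.
(* Only exponents divisible by [D] contribute, so the limits are compared along multiples of [D]. *)
have E n : series v (n * D)%N = series u n.
  elim: n => [|n IH]; first by rewrite mul0n /series /= !big_geq.
  rewrite [RHS]seriesSr -IH mulSn addnC /series /= (big_cat_nat (n := (n * D)%N)) //=; last by lia.
  congr (_ + _); rewrite big_ltn; last by lia.
  rewrite big_nat_cond big1 ?addr0.
    rewrite /v /u /spread dvdn_mull // mulnK // rmorphM rmorphXn -mulrA -exprMn.
    by rewrite mulnC exprM.
  move=> i /andP[/andP[Hi1 Hi2] _]; rewrite /v /spread; case: ifP => [|_]; last by rewrite mul0r.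
  by move=> /dvdnP[q Hq]; exfalso; have [qn|nq] := leqP q n; nia.
apply/esym; apply: (cvgC_unique hu).
exact: (cvg_ext E (cvg_multiples D0 hv)).
Qed.

Lemma spread_mul D (c : R) a (q : nat -> R) : (0 < D)%N ->
  (fun k => q k * spread D c a k) = spread D c (fun j => q (D * j)%N * a j).
Proof.
move=> D0; apply/funext => k; rewrite /spread; case: ifP => [Dk|_]; last by rewrite mulr0.
by rewrite mulrA [(D * _)%N]mulnC divnK.
Qed.

(** The remainder of exponent [n + 2] is [z + h] times that of exponent [n + 1], plus
    [(n + 1) h^2 z^n]. Since [1 <= r], one power of [r] majorizes all lower ones. *)
Lemma pow_taylor2 z h (r : R) n : 1 <= r -> cmod z <= r -> cmod (z + h) <= r ->
  cmod ((z + h) ^+ n - z ^+ n - n%:R * h * z ^+ n.-1) <= cmod h ^+ 2 * (n%:R ^+ 2 * r ^+ n).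
Proof.
move=> r1 zr zhr; have r0 : 0 <= r by exact: le_trans r1.
elim: n => [|n IH].
  by rewrite !expr0 subrr !mul0r subrr (_ : 0 = (0 : R)%:C :> C) // cmod_real normr0 expr0n !mul0r mulr0.
case: n IH => [_|n IH].
  rewrite (_ : (z + h) ^+ 1 - z ^+ 1 - 1%:R * h * z ^+ 1.-1 = 0); last by rewrite /=; ring.
  by rewrite (_ : 0 = (0 : R)%:C :> C) // cmod_real normr0 mulr_ge0 ?sqr_ge0 // expr1 mulr_ge0 ?sqr_ge0.
have -> : (z + h) ^+ n.+2 - z ^+ n.+2 - n.+2%:R * h * z ^+ n.+2.-1 =
   (z + h) * ((z + h) ^+ n.+1 - z ^+ n.+1 - n.+1%:R * h * z ^+ n.+1.-1)
   + n.+1%:R * h ^+ 2 * z ^+ n.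
  rewrite /= !exprS -[n.+2]addn1 -[n.+1]addn1 !natrD; ring.
apply: le_trans (cmodD _ _) _; rewrite !cmodM.
have -> : cmod (n.+1%:R : C) = n.+1%:R.
  by rewrite (_ : n.+1%:R = (n.+1%:R : R)%:C :> C) ?cmod_real ?normr_nat // rmorph_nat.
apply: (@le_trans _ _ (r * (cmod h ^+ 2 * (n.+1%:R ^+ 2 * r ^+ n.+1))
   + n.+1%:R * cmod h ^+ 2 * r ^+ n.+2)).
  apply: lerD; first by apply: ler_pM => //; exact: cmod_ge0.
  rewrite !cmodX; apply: ler_wpM2l; first by rewrite mulr_ge0 // sqr_ge0.
  apply: (@le_trans _ _ (r ^+ n)); first by rewrite lerXn2r // nnegrE // cmod_ge0.
  by rewrite ler_weXn2l // leqW.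
have -> : r * (cmod h ^+ 2 * (n.+1%:R ^+ 2 * r ^+ n.+1)) + n.+1%:R * cmod h ^+ 2 * r ^+ n.+2
  = cmod h ^+ 2 * ((n.+1%:R ^+ 2 + n.+1%:R) * r ^+ n.+2) by rewrite [r ^+ n.+2]exprS; ring.
rewrite ler_wpM2l ?sqr_ge0 // ler_wpM2r ?exprn_ge0 //.
have n0 : 0 <= n%:R :> R by [].
rewrite -[n.+2]addn1 -[n.+1]addn1 !natrD; nra.
Qed.

(** Sum [pow_taylor2] termwise; [K] is the sum of [n^2 |a_n| r^n], finite because [a] is entire. *)
Lemma pser_taylor2 a z : entire a -> exists2 K : R, 0 <= K &
  forall h, cmod h <= 1 ->
   cmod (pser a (z + h) - pser a z - h * pser (diffs a) z) <= cmod h ^+ 2 * K.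
Proof.
move=> ea; set r := cmod z + 1.
have r1 : 1 <= r by rewrite lerDr cmod_ge0.
have zr : cmod z <= r by rewrite lerDl.
set v := fun n => `|n%:R * (n%:R * a n)| * r ^+ n.
have cv : cvgn (series v).
  apply: (@entire_abscv (fun n => n%:R * (n%:R * a n))); first exact: le_trans r1.
  by do 2 apply: entire_natM.
have v0 n : 0 <= v n by rewrite mulr_ge0 // exprn_ge0 // (le_trans _ r1).
exists (limn (series v)).
  apply: (le_trans _ (nondecreasing_cvgn_le (u_ := series v) _ cv 0)); first by rewrite /series /= big_geq.
  by apply/nondecreasing_seqP => m; rewrite seriesSr lerDl.
move=> h h1; have zhr : cmod (z + h) <= r by apply: le_trans (cmodD _ _) _; rewrite lerD2l.
set u := fun n => (a n)%:C * ((z + h) ^+ n - z ^+ n - n%:R * h * z ^+ n.-1) : C.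
have uv n : cmod (u n) <= (cmod h ^+ 2 *: v) n.
  rewrite /u cmodM cmod_real; have := pow_taylor2 n r1 zr zhr => H.
  apply: le_trans (ler_wpM2l (normr_ge0 _) H) _.
  rewrite fctE /v !normrM normr_nat /GRing.scale /=.
  by rewrite le_eqVlt; apply/orP; left; apply/eqP; ring.
have cu : series u @ \oo --> pser a (z + h) - pser a z - h * pser (diffs a) z.
  have c1 := pser_cvg (entire_cmod (z:=z + h) ea).
  have c2 := pser_cvg (entire_cmod (z:=z) ea).
  have c3 := pser_cvg (entire_cmod (z:=z) (entire_diffs ea)).
  rewrite -cvg_shiftS.
  have H : (fun N => series (fun n => (a n)%:C * (z + h) ^+ n : C) N.+1 - series (fun n => (a n)%:C * z ^+ n : C) N.+1
      - h * series (fun n => (diffs a n)%:C * z ^+ n : C) N) @ \oo --> pser a (z + h) - pser a z - h * pser (diffs a) z.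
    apply: cvgB; first exact: cvgB (cvg_succ c1) (cvg_succ c2).
    by apply: cvgM c3; exact: cvg_cst.
  apply: (cvg_ext _ H) => N; rewrite /series /= mulr_sumr.
  have -> : \sum_(0 <= i < N) h * ((diffs a i)%:C * z ^+ i : C) = \sum_(0 <= i < N.+1) (i%:R * h * (a i)%:C * z ^+ i.-1 : C).
    rewrite [RHS]big_nat_recl //= !mul0r add0r; apply: eq_bigr => i _.
    by rewrite /diffs rmorphM rmorph_nat; ring.
  rewrite -!sumrB; apply: eq_bigr => i _; rewrite /u; ring.
have [_] := series_dominated uv (is_cvg_seriesZ (k := cmod h ^+ 2) cv).
by rewrite (limC_eq cu) lim_seriesZ.
Qed.

Lemma derive1_pser a z : entire a -> derive1 (pser a) z = pser (diffs a) z.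
Proof.
move=> ea; have [K K0 HK] := pser_taylor2 z ea.
rewrite /derive1; apply: cvg_lim; first exact: norm_hausdorff.
apply/cvgrPdist_lt => e e0; have eE : e = (complex.Re e)%:C by rewrite RRe_real ?gtr0_real.
set e' := complex.Re e in eE; have e0' : 0 < e' by rewrite -ltcR -eE.
have d0 : 0 < Num.min 1 (e' / (K + 1)) by rewrite lt_min ltr01 divr_gt0 // ltr_wpDl.
have d0C : 0 < (Num.min 1 (e' / (K + 1)))%:C :> C by rewrite ltcR.
near=> h.
have h0 : h != 0 by near: h; exact: nbhs_dnbhs_neq.
have hd : cmod h < Num.min 1 (e' / (K + 1)).
  rewrite -ltcR -cmodE; near: h; apply: dnbhs0_lt; exact: d0C.
move: hd; rewrite lt_min => /andP[h1 h2].
have := HK h (ltW h1); set w := _ - _ - _ => Hw.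
have -> : pser (diffs a) z - h^-1 *: (pser a (h + z) - pser a z) = - (h^-1 * w).
  by rewrite /w mulrBr mulKf // opprB [h + z]addrC.
rewrite normrN cmodE eE ltcR cmodM.
have ch : 0 < cmod h.
  rewrite lt_def cmod_ge0 andbT; apply: contra h0 => /eqP c0.
  by rewrite -normr_eq0 cmodE c0.
have -> : cmod h^-1 = (cmod h)^-1.
  by apply: complexI; rewrite fmorphV /= -!cmodE normfV.
apply: (@le_lt_trans _ _ (cmod h * K)).
  by rewrite ler_pdivrMl // mulrA -expr2.
move: h2; rewrite ltr_pdivlMr; last by rewrite ltr_wpDl.
have := ch; nra.
Unshelve. all: by end_near.
Qed.

End EntireSeries.

(** * Formal power series and Newton's identities *)

Section FormalSeries.
Variable R : realType.
Implicit Types (a b c : nat -> R) (n : nat).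

Definition euler a n : R := n%:R * a n.
Definition delta0 n : R := (n == 0%N)%:R.

(** Truncation turns convolutions into polynomial products, whose commutativity and associativity
    then carry over to [conv]. *)
Lemma coef_conv a b N n : (n < N)%N ->
  (\poly_(i < N) a i * \poly_(i < N) b i)`_n = conv a b n.
Proof.
move=> nN; rewrite coefM; apply: eq_bigr => k _; rewrite !coef_poly.
rewrite (leq_ltn_trans _ nN) ?(leq_ltn_trans (leq_subr _ _) nN) //.
by rewrite -ltnS.
Qed.

Lemma convC a b : conv a b = conv b a.
Proof. by apply/funext => n; rewrite -!(@coef_conv _ _ n.+1) // mulrC. Qed.

Lemma convA a b c : conv a (conv b c) = conv (conv a b) c.
Proof.
apply/funext => n.
transitivity (\poly_(i < n.+1) a i * (\poly_(i < n.+1) b i * \poly_(i < n.+1) c i))`_n.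
  rewrite coefM; apply: eq_bigr => k _; rewrite coef_poly ltn_ord coef_conv //.
  by rewrite ltnS leq_subr.
rewrite mulrA coefM; apply: eq_bigr => k _.
by rewrite coef_conv // coef_poly ltnS leq_subr.
Qed.

Lemma conv1 a : conv delta0 a = a.
Proof.
apply/funext => n; rewrite /conv big_ord_recl /delta0 /= mul1r subn0 big1 ?addr0 //.
by move=> i _; rewrite mul0r.
Qed.

Lemma convDr a b c : conv a (fun n => b n + c n) = (fun n => conv a b n + conv a c n).
Proof.
by apply/funext => n; rewrite /conv -big_split; apply: eq_bigr => k _; rewrite mulrDr.
Qed.

Lemma convNr a b : conv a (fun n => - b n) = (fun n => - conv a b n).
Proof.
by apply/funext => n; rewrite /conv -sumrN; apply: eq_bigr => k _; rewrite mulrN.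
Qed.

Lemma euler_conv a b :
  euler (conv a b) = (fun n => conv (euler a) b n + conv a (euler b) n).
Proof.
apply/funext => n; rewrite /euler /conv mulr_sumr -big_split; apply: eq_bigr => k _ /=.
have kn : (k <= n)%N by rewrite -ltnS.
by rewrite -{1}(subnKC kn) natrD; ring.
Qed.

(** Each coefficient of the reciprocal depends on all earlier ones, so the recursion carries the
    whole list. *)
Fixpoint inv_prefix a n : seq R :=
  if n is m.+1 then
    rcons (inv_prefix a m) (- \sum_(k < m.+1) a k.+1 * (inv_prefix a m)`_(m - k))
  else [:: 1].

(* Coefficients of the reciprocal of a power series with constant term 1. *)
Definition inv_series a n : R := (inv_prefix a n)`_n.

Lemma size_inv_prefix a n : size (inv_prefix a n) = n.+1.
Proof. by elim: n => //= n IH; rewrite size_rcons IH. Qed.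

Lemma nth_inv_prefix a n k : (k <= n)%N -> (inv_prefix a n)`_k = inv_series a k.
Proof.
elim: n => [|n IH]; first by rewrite leqn0 => /eqP ->.
rewrite leq_eqVlt => /orP[/eqP -> //|kn]; rewrite /= nth_rcons size_inv_prefix kn.
exact: IH.
Qed.

Lemma inv_seriesS a n :
  inv_series a n.+1 = - \sum_(k < n.+1) a k.+1 * inv_series a (n - k)%N.
Proof.
rewrite /inv_series /= nth_rcons size_inv_prefix ltnn eqxx; congr (- _).
by apply: eq_bigr => k _; rewrite nth_inv_prefix // leq_subr.
Qed.

Lemma conv_inv a : a 0%N = 1 -> conv a (inv_series a) = delta0.
Proof.
move=> a0; apply/funext => -[|n]; rewrite /conv.
  by rewrite big_ord1 a0 mul1r.
by rewrite big_ord_recl a0 mul1r subn0 inv_seriesS addNr.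
Qed.

(* Power sums of the reciprocals of the zeros of the series, read off from
   the logarithmic derivative. *)
Definition psum a n : R := - conv (euler a) (inv_series a) n.

Lemma conv_psum a : a 0%N = 1 -> conv a (psum a) = (fun n => - euler a n).
Proof.
move=> a0; rewrite convNr; apply/funext => n; congr (- _).
by rewrite [conv (euler a) _]convC convA conv_inv // conv1.
Qed.

Lemma psum_unique a s : a 0%N = 1 -> conv a s = (fun n => - euler a n) -> s = psum a.
Proof.
move=> a0 E; rewrite -[s]conv1 -(conv_inv a0) [conv a _]convC -convA E convNr.
by apply/funext => n; rewrite /psum convC.
Qed.

(** Apply [euler] to the identity [conv a (inv_series a) = delta0]. The result is a recurrence for
    the reciprocal weighted by the power sums, the source of its positivity and convergence. *)
Lemma euler_inv a : a 0%N = 1 -> euler (inv_series a) = conv (psum a) (inv_series a).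
Proof.
move=> a0; rewrite -[LHS]conv1 -(conv_inv a0) [conv a _]convC -convA convC; congr (conv _ _).
have H : euler (conv a (inv_series a)) = fun=> 0.
  by rewrite conv_inv //; apply/funext => -[|n]; rewrite /euler /delta0 ?mul0r ?mulr0.
move: H; rewrite euler_conv => H; apply/funext => n; have := congr1 (@^~ n) H.
by rewrite /psum /= => /eqP; rewrite addrC addr_eq0 => /eqP.
Qed.

Lemma psum0 a : psum a 0 = 0.
Proof. by rewrite /psum /conv big_ord1 /euler !mul0r oppr0. Qed.

Lemma psum1 a : psum a 1 = - a 1%N.
Proof.
by rewrite /psum /conv !big_ord_recl big_ord0 /euler /= mul0r mul0r add0r addr0 mul1r /inv_series mulr1.
Qed.

Lemma psum2 a : psum a 2 = a 1%N ^+ 2 - 2 * a 2%N.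
Proof.
have e0 : inv_series a 0 = 1 by [].
have e1 : inv_series a 1 = - a 1%N by rewrite inv_seriesS big_ord1 mulr1.
rewrite /psum /conv !big_ord_recl big_ord0 /euler /=.
rewrite subnn subSnn e0 e1 -[bump 0 (bump 0 0)]/2%N -[bump 0 0]/1%N; ring.
Qed.

Lemma conv_cvg_pointwise (A B : nat -> nat -> R) a b n :
  (forall k, (k <= n)%N -> (fun j => A j k) @ \oo --> a k) ->
  (forall k, (k <= n)%N -> (fun j => B j k) @ \oo --> b k) ->
  (fun j => conv (A j) (B j) n) @ \oo --> conv a b n.
Proof.
move=> HA HB; rewrite /conv; apply: cvg_big => [|k _].
  exact: add_continuous.
by apply: cvgM; [apply: HA; rewrite -ltnS|apply: HB; exact: leq_subr].
Qed.

Lemma inv_series_cvg (A : nat -> nat -> R) a :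
  (forall k, (fun j => A j k) @ \oo --> a k) ->
  forall n, (fun j => inv_series (A j) n) @ \oo --> inv_series a n.
Proof.
move=> HA n; have [m] := ubnP n; elim: m n => // m IH [|n] nm; first exact: cvg_cst.
under eq_fun do rewrite inv_seriesS; rewrite inv_seriesS; apply: cvgN.
apply: cvg_big => [|k _]; first exact: add_continuous.
by apply: cvgM; [exact: HA|apply: IH; lia].
Qed.

(** Each power sum is a polynomial in finitely many coefficients, hence continuous in them. *)
Lemma psum_cvg (A : nat -> nat -> R) a :
  (forall k, (fun j => A j k) @ \oo --> a k) ->
  forall n, (fun j => psum (A j) n) @ \oo --> psum a n.
Proof.
move=> HA n; apply: cvgN; apply: conv_cvg_pointwise => k _; last exact: inv_series_cvg.
by apply: cvgM; [exact: cvg_cst|exact: HA].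
Qed.

Definition lin_factor (x : R) : {poly R} := 1 - x *: 'X.

Lemma coef0_prod_lin (I : Type) (r : seq I) (x : I -> R) :
  (\prod_(i <- r) lin_factor (x i))`_0 = 1.
Proof.
rewrite -horner_coef0 horner_prod big1 // => i _.
by rewrite /lin_factor hornerD hornerN hornerZ hornerX mulr0 subr0 hornerC.
Qed.

Lemma coefM_conv (p q : {poly R}) : (fun n => (p * q)`_n) = conv (fun n => p`_n) (fun n => q`_n).
Proof. by apply/funext => n; rewrite coefM. Qed.

(** The logarithmic derivative of a product is the sum over its factors; [psum_unique] identifies
    that sum. *)
Lemma psum_prod_lin (I : Type) (r : seq I) (x : I -> R) m :
  psum (fun n => (\prod_(i <- r) lin_factor (x i))`_n) m.+1 = \sum_(i <- r) x i ^+ m.+1.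
Proof.
(* Coefficients of [y w / (1 - y w)], the contribution of one linear factor; the constant term is 0
   and not [y ^+ 0]. *)
pose g (y : R) n := if n is 0%N then 0 else y ^+ n.
pose P r := fun n => (\prod_(i <- r) lin_factor (x i))`_n.
suff H : (fun n => \sum_(i <- r) g (x i) n) = psum (P r).
  by rewrite -/(P r) -H; apply: eq_bigr.
apply: psum_unique; first exact: coef0_prod_lin.
elim: r => [|i r IH].
  apply/funext => n; rewrite /conv big1 => [|k _]; last by rewrite big_nil mulr0.
  by rewrite /euler /P big_nil coef1; case: n => [|n] /=; rewrite ?mul0r ?mulr0 oppr0.
have -> : P (i :: r) = conv (fun n => (lin_factor (x i))`_n) (P r).
  by rewrite /P -coefM_conv; apply/funext => n; rewrite big_cons.
under [X in conv _ X]eq_fun do rewrite big_cons.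
set l := (fun n => (lin_factor (x i))`_n).
have lg : conv l (g (x i)) = (fun n => - euler l n).
  apply/funext => n; rewrite /conv /euler /l /lin_factor.
  case: n => [|n]; first by rewrite big_ord1 /= mulr0 mul0r oppr0.
  rewrite !big_ord_recl !coefB !coefZ !coefX !coef1 /= big1 ?addr0; last first.
    by move=> k _; rewrite coefB coefZ coefX coef1 /= mulr0 subrr mul0r.
  case: n => [|n] /=; first by ring.
  by rewrite subn0 -[bump 0 0]/1%N subn1 /= [x i ^+ n.+2]exprS; ring.
rewrite convDr euler_conv; apply/funext => n.
rewrite -[in X in _ + X]convA IH convNr.
rewrite [conv l (P r)]convC -convA lg convNr opprD; congr (- _ - _).
by rewrite convC.
Qed.

End FormalSeries.

(** * Limits of polynomials with positive zeros *)

Section HyperbolicPolynomials.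
Variable R : realType.
Implicit Types (p q : {poly R}) (w : nat -> R) (K : nat).

(** The constant term is normalised to 1, and the strictly increasing enumeration of the zeros makes
    them simple. *)
Definition simple_pos_rooted p : Prop :=
  exists K (w : nat -> R),
    [/\ forall j, (j < K)%N -> 0 < w j,
        forall i j, (i < j < K)%N -> w i < w j
      & p = \prod_(j < K) lin_factor (w j)^-1].

Lemma horner_lin_factor (x y : R) : (lin_factor x).[y] = 1 - x * y.
Proof. by rewrite /lin_factor hornerD hornerN hornerZ hornerX hornerC. Qed.

Lemma size_prod_lin_factor K (x : nat -> R) :
  (size (\prod_(j < K) lin_factor (x j))%R <= K.+1)%N.
Proof.
elim: K => [|K IH]; first by rewrite big_ord0 size_poly1.
rewrite big_ord_recr /=; apply: leq_trans (size_polyMleq _ _) _.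
have : (size (lin_factor (x K)) <= 2)%N.
  rewrite /lin_factor -opprB size_polyN (leq_trans (size_polyD _ _)) // geq_max.
  by rewrite (leq_trans (size_scale_leq _ _)) ?size_polyX // size_polyN size_poly1.
move: IH; set s1 := size _; set s2 := size _; lia.
Qed.

(** The [K] sign changes give [K] distinct positive zeros by the intermediate value theorem. The
    degree bound leaves room for no others, and [q.[0] = 1] fixes the constant factor. *)
Lemma sign_changes_simple_pos_rooted K (v : nat -> R) q :
  v 0%N = 0 -> (forall j, (j < K)%N -> v j < v j.+1) ->
  (forall j, (j <= K)%N -> 0 < (-1) ^+ j * q.[v j]) ->
  (size q <= K.+1)%N -> q.[0] = 1 -> simple_pos_rooted q.
Proof.
move=> v0 vS qs sq q0.
have /choice[y Hy] : forall j, exists y, (j < K)%N -> v j < y < v j.+1 /\ root q y.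
  move=> j; case: (ltnP j K) => [jK|_]; last by exists 0.
  have s : q.[v j] * q.[v j.+1] < 0.
    have := mulr_gt0 (qs j (ltnW jK)) (qs j.+1 jK).
    rewrite exprS mulN1r mulNr mulrN mulrACA -expr2 sqrr_sign mul1r.
    by rewrite oppr_gt0.
  have [y] := polyrcf.poly_ivtoo (ltW (vS _ jK)) s; rewrite in_itv /= => yv ry.
  by exists y.
have vmono i j : (i <= j <= K)%N -> v i <= v j.
  move=> /andP[]; elim: j => [|j IH]; first by rewrite leqn0 => /eqP ->.
  rewrite leq_eqVlt => /orP[/eqP -> //|ij] jK.
  by apply: le_trans (IH _ (ltnW jK)) (ltW (vS _ jK)).
have ypos j : (j < K)%N -> 0 < y j.
  move=> jK; have [/andP[h _] _] := Hy _ jK; apply: le_lt_trans h.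
  by rewrite -v0; apply: vmono; rewrite /= ltnW.
have ymono i j : (i < j < K)%N -> y i < y j.
  move=> /andP[ij jK]; have [/andP[_ h1] _] := Hy i (ltn_trans ij jK).
  have [/andP[h2 _] _] := Hy _ jK; apply: lt_trans h1 _; apply: le_lt_trans h2.
  by apply: vmono; rewrite ij ltnW.
exists K, y; split => //.
set rs := [seq y j | j <- iota 0 K].
have srs : size rs = K by rewrite size_map size_iota.
have rrs : all (root q) rs.
  apply/allP => x /mapP[j]; rewrite mem_iota add0n => /andP[_ jK] ->.
  exact: (proj2 (Hy _ jK)).
have urs : uniq rs.
  rewrite map_inj_in_uniq ?iota_uniq // => i j; rewrite !mem_iota !add0n => /andP[_ iK] /andP[_ jK] E.
  case: (ltngtP i j) => // ij; first by have := ymono i j; rewrite ij jK E ltxx => /(_ isT).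
  by have := ymono j i; rewrite ij iK E ltxx => /(_ isT).
have q_neq0 : q != 0 by apply/eqP => qq; move: q0; rewrite qq horner0 => /esym/eqP; rewrite oner_eq0.
have sqK : size q = (size rs).+1.
  by apply/eqP; rewrite eqn_leq srs sq /= -{1}srs; apply: max_poly_roots.
have urs' : uniq_roots rs by rewrite uniq_rootsE.
have qE := all_roots_prod_XsubC sqK rrs urs'.
rewrite big_map -[K in iota 0 K]subn0 -/(index_iota 0 K) big_mkord in qE.
(* Passing from monic factors to factors with constant term 1 costs a scalar, which evaluation at 0
   then determines. *)
have pE : \prod_(j < K) ('X - (y j)%:P) =
    (\prod_(j < K) - y j)%:P * \prod_(j < K) lin_factor (y j)^-1.
  rewrite rmorph_prod -big_split; apply: eq_bigr => j _.
  have yj : y j != 0 by rewrite gt_eqF // ypos.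
  rewrite /lin_factor /= mulrBr mulr1 rmorphN /= mulNr opprK mul_polyC scalerA.
  by rewrite divff // scale1r addrC.
rewrite pE mul_polyC scalerA in qE.
have P0 : (\prod_(j < K) lin_factor (y j)^-1).[0] = 1.
  by rewrite horner_prod big1 // => j _; rewrite horner_lin_factor mulr0 subr0.
by move: q0; rewrite {1}qE hornerZ P0 mulr1 => c1; rewrite qE c1 scale1r.
Qed.

(** The [j] factors with [i < j] are negative and the remaining ones positive; this gives the
    alternating sign of [p'] at successive zeros. *)
Lemma sgr_prod_nodes K w j : (forall i, (i < K)%N -> 0 < w i) ->
  (forall i l, (i < l < K)%N -> w i < w l) -> (j < K)%N ->
  0 < (-1) ^+ j * \prod_(i < K | i != j :> nat) (1 - (w i)^-1 * w j).
Proof.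
move=> w0 wm jK.
rewrite -(big_mkord (fun i => i != j) (fun i => 1 - (w i)^-1 * w j)).
rewrite (big_cat_nat (n := j)) //=; last exact: ltnW.
rewrite mulrA; apply: mulr_gt0.
  rewrite big_nat_cond (eq_bigr (fun i => - ((w i)^-1 * w j - 1))); last by move=> i _; rewrite opprB.
  rewrite (eq_bigl (fun i => (0 <= i < j)%N)); last first.
    by move=> i /=; case: (ltngtP i j); rewrite ?andbF.
  rewrite -big_nat big_mkord prodrN card_ord mulrA -expr2 sqrr_sign mul1r.
  apply: prodr_gt0 => i _; rewrite subr_gt0 ltr_pdivlMl ?mulr1 ?wm ?ltn_ord //.
  by rewrite w0 // (ltn_trans _ jK).
rewrite big_nat_cond; apply: prodr_gt0 => i /andP[/andP[ji iK] nij].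
have {}ji : (j < i)%N by rewrite ltn_neqAle eq_sym nij.
by rewrite subr_gt0 mulrC ltr_pdivrMr ?mul1r ?wm ?w0 // ji.
Qed.

(** At a zero [w j] of [p] the new polynomial equals [w j * p'(w j) / beta], whose sign alternates
    with [j], and the degree does not grow. *)
Lemma simple_pos_rooted_multiplier p (beta : R) : 0 < beta -> simple_pos_rooted p ->
  simple_pos_rooted (p + beta^-1 *: ('X * p^`())).
Proof.
move=> b0 [K [w [w0 wm pE]]]; set q := p + _.
have p_root j : (j < K)%N -> p.[w j] = 0.
  move=> jK; rewrite pE horner_prod (bigD1 (Ordinal jK)) //= horner_lin_factor.
  by rewrite mulVf ?subrr ?mul0r // gt_eqF // w0.
have dp j : (j < K)%N -> p^`().[w j] =
    - (w j)^-1 * \prod_(i < K | i != j :> nat) (1 - (w i)^-1 * w j).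
  move=> jK; rewrite pE (bigD1 (Ordinal jK)) //= derivM hornerD !hornerM horner_lin_factor.
  rewrite mulVf ?gt_eqF ?w0 // subrr mul0r addr0; congr (_ * _).
    by rewrite /lin_factor derivB derivZ derivX derivC hornerD hornerN hornerZ !hornerC mulr1 add0r.
  by rewrite horner_prod; apply: eq_bigr => i _; rewrite horner_lin_factor.
(* The node 0, where the value is 1, precedes the zeros of [p] and supplies the sign change before
   the first one. *)
pose v j := if j is j'.+1 then w j' else 0.
apply: (@sign_changes_simple_pos_rooted K v) => //.
- move=> [|j] jK; first exact: w0.
  by apply: wm; rewrite ltnSn.
- move=> [|j] jK.
    rewrite /= mul1r /q hornerD hornerZ hornerM hornerX mul0r mulr0 addr0 pE horner_prod.
    by apply: prodr_gt0 => i _; rewrite horner_lin_factor mulr0 subr0.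
  rewrite /= /q hornerD hornerZ hornerM hornerX p_root // add0r dp //.
  have wj : 0 < w j by exact: w0.
  have := sgr_prod_nodes w0 wm jK; set P := \prod_(i < K | _) _ => HP.
  rewrite (_ : _ * _ = beta^-1 * ((-1) ^+ j * P)); first by rewrite mulr_gt0 // invr_gt0.
  by rewrite exprS; field; rewrite !gt_eqF.
- have sp : (size p <= K.+1)%N by rewrite pE (size_prod_lin_factor K (fun j => (w j)^-1)).
  rewrite /q (leq_trans (size_polyD _ _)) // geq_max sp /=.
  apply: leq_trans (size_scale_leq _ _) _; apply: leq_trans (size_polyMleq _ _) _.
  rewrite size_polyX /=; case: (eqVneq p 0) => [->|p0]; first by rewrite deriv0 size_poly0.
  by apply: leq_trans sp; exact: lt_size_deriv.
- rewrite /q hornerD hornerZ hornerM hornerX mul0r mulr0 addr0 pE horner_prod big1 // => i _.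
  by rewrite horner_lin_factor mulr0 subr0.
Qed.

Lemma simple_pos_rooted_scale p (l : R) : 0 < l -> simple_pos_rooted p ->
  simple_pos_rooted (p \Po (l *: 'X)).
Proof.
move=> l0 [K [w [w0 wm ->]]]; exists K, (fun j => w j / l); split.
- by move=> j jK; rewrite divr_gt0 // w0.
- by move=> i j ij; rewrite ltr_pM2r ?invr_gt0 // wm.
- rewrite rmorph_prod; apply: eq_bigr => j _ /=.
  by rewrite /lin_factor comp_polyB comp_polyZ comp_polyX scalerA invf_div mulrC comp_polyC.
Qed.

End HyperbolicPolynomials.

(** * Coefficientwise limits, multipliers and Gauss products *)

Section HyperbolicSequences.
Variable R : realType.
Implicit Types (p q : {poly R}) (a b c : nat -> R).

(* Asking for simple zeros, rather than merely positive ones, is what lets the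
   multipliers be handled by counting sign changes. *)
Definition hyperbolic a : Prop :=
  forall N (e : R), 0 < e -> exists p, simple_pos_rooted p /\
    forall n, (n <= N)%N -> `|p`_n - a n| < e.

Lemma simple_pos_rooted_hyperbolic p : simple_pos_rooted p -> hyperbolic (fun n => p`_n).
Proof. by move=> pp N e e0; exists p; split=> // n _; rewrite subrr normr0. Qed.

(** On coefficients the multiplier is [p + w p' / b]; up to index [N] it enlarges errors by at most
    [1 + N / b]. *)
Lemma hyperbolic_multiplier (b : R) a : 0 < b -> hyperbolic a ->
  hyperbolic (fun n => (1 + n%:R / b) * a n).
Proof.
move=> b0 ha N e e0.
have k0 : 0 < 1 + N%:R / b by rewrite ltr_wpDr // divr_ge0 // ltW.
have [p [pp pa]] := ha N _ (divr_gt0 e0 k0).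
exists (p + b^-1 *: ('X * p^`())); split; first exact: simple_pos_rooted_multiplier.
move=> n nN; have := pa n nN; rewrite ltr_pdivlMr // => H.
have -> : (p + b^-1 *: ('X * p^`()))`_n = (1 + n%:R / b) * p`_n.
  rewrite coefD coefZ coefXM; case: n {nN H} => [|n] /=; first by rewrite mulr0 mul0r !addr0 mul1r.
  by rewrite coef_deriv -mulr_natl; ring.
rewrite -mulrBr normrM mulrC; apply: le_lt_trans H; rewrite ler_wpM2l //.
rewrite ger0_norm; last by rewrite addr_ge0 // divr_ge0 // ltW.
by rewrite lerD2l ler_wpM2r ?ler_nat // invr_ge0 ltW.
Qed.

Lemma hyperbolic_scale (l : R) a : 0 < l -> hyperbolic a ->
  hyperbolic (fun n => l ^+ n * a n).
Proof.
move=> l0 ha N e e0.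
(* Since [l + 1 >= 1], this power bounds every [l ^+ n] with [n <= N], even for [l < 1]. *)
have k0 : 0 < (l + 1) ^+ N by rewrite exprn_gt0 // addr_gt0.
have [p [pp pa]] := ha N _ (divr_gt0 e0 k0).
exists (p \Po (l *: 'X)); split; first exact: simple_pos_rooted_scale.
move=> n nN; have := pa n nN; rewrite ltr_pdivlMr // => H.
have -> : (p \Po (l *: 'X))`_n = l ^+ n * p`_n.
  rewrite coef_comp_poly.
  under eq_bigr do rewrite exprZn coefZ coefXn.
  have [np|np] := ltnP n (size p); last first.
    rewrite [p`_n]nth_default // mulr0 big1 // => i _.
    by rewrite gtn_eqF ?mulr0 // (leq_trans (ltn_ord i)).
  rewrite (bigD1 (Ordinal np)) //= eqxx mulr1 big1 ?addr0 1?mulrC // => i ni.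
  by rewrite eq_sym (negbTE (ni : (i : nat) != n)) !mulr0.
rewrite -mulrBr normrM mulrC; apply: le_lt_trans H; rewrite ler_wpM2l //.
rewrite ger0_norm ?exprn_ge0 ?(ltW l0) //.
apply: (@le_trans _ _ ((l + 1) ^+ n)).
  by rewrite lerXn2r ?nnegrE ?(ltW l0) ?addr_ge0 ?(ltW l0) // lerDl.
by rewrite ler_weXn2l // lerDr ltW.
Qed.

Lemma hyperbolic_lim (A : nat -> nat -> R) a : (forall j, hyperbolic (A j)) ->
  (forall n, (fun j => A j n) @ \oo --> a n) -> hyperbolic a.
Proof.
move=> hA cA N e e0; have e2 : 0 < e / 2 by rewrite divr_gt0.
have [j Hj] : exists j, forall n, (n <= N)%N -> `|a n - A j n| < e / 2.
  (* Thresholds valid for all larger [j] can be merged over finitely many [n] by a maximum. *)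
  have [j Hj] : exists J, forall j, (J <= j)%N -> forall n, (n <= N)%N -> `|a n - A j n| < e / 2.
    elim: N => [|N [J HJ]].
      move/cvgrPdist_lt: (cA 0%N) => /(_ _ e2) [J _ HJ]; exists J => j Jj n.
      by rewrite leqn0 => /eqP ->; exact: HJ.
    move/cvgrPdist_lt: (cA N.+1) => /(_ _ e2) [J' _ HJ']; exists (maxn J J') => j.
    rewrite geq_max => /andP[Jj J'j] n; rewrite leq_eqVlt => /orP[/eqP ->|nN].
      exact: HJ'.
    exact: HJ.
  by exists j; exact: Hj.
have [p [pp pa]] := hA j N _ e2; exists p; split=> // n nN.
rewrite -(subrKA (A j n)) addrC; apply: le_lt_trans (ler_normD _ _) _.
have := pa n nN; have := Hj n nN; rewrite distrC; lra.
Qed.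

Lemma cvg_inv_succ : (fun j => j.+1%:R^-1 : R) @ \oo --> (0 : R).
Proof. exact: cvg_harmonic. Qed.

(** The multiple zero 1 is split into the simple zeros [1 + k / (j + 1)], which merge again as [j]
    grows. *)
Lemma hyperbolic_pow M : hyperbolic (fun n => (lin_factor (1 : R) ^+ M)`_n).
Proof.
pose w (j k : nat) : R := 1 + k%:R * j.+1%:R^-1.
have w0 j k : 0 < w j k by rewrite ltr_wpDr // mulr_ge0.
apply: (@hyperbolic_lim (fun j n => (\prod_(k < M) lin_factor (w j k)^-1)`_n)).
  move=> j; apply: simple_pos_rooted_hyperbolic; exists M, (w j); split=> //.
  by move=> i k /andP[ik _]; rewrite ltrD2l ltr_pM2r ?ltr_nat.
elim: M => [|M IH] n.
  under eq_fun do rewrite big_ord0; rewrite expr0; exact: cvg_cst.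
under eq_fun do rewrite big_ord_recr /= coefM; rewrite exprSr coefM.
apply: (@conv_cvg_pointwise R (fun j k => (\prod_(i < M) lin_factor (w j i)^-1)`_k)
  (fun j k => (lin_factor (w j M)^-1)`_k) (fun k => (lin_factor 1 ^+ M)`_k)
  (fun k => (lin_factor 1)`_k)) => k _; first exact: IH.
under eq_fun do rewrite /lin_factor coefB coefZ.
rewrite /lin_factor coefB coefZ; apply: cvgB; first exact: cvg_cst.
apply: cvgM; last exact: cvg_cst.
rewrite -[1 in X in _ --> X]invr1; apply: cvgV; first exact: oner_neq0.
have H : (fun j => w j M) @ \oo --> 1 + M%:R * (0 : R).
  apply: cvgD; first exact: cvg_cst.
  by apply: cvgM; [exact: cvg_cst|exact: cvg_inv_succ].
by rewrite mulr0 addr0 in H.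
Qed.

Lemma coef_lin_factor_exp M n : (lin_factor (1 : R) ^+ M)`_n = (-1) ^+ n * 'C(M, n)%:R.
Proof.
rewrite /lin_factor scale1r; elim: M n => [|M IH] [|n].
- by rewrite expr0 coef1 bin0 mulr1.
- by rewrite expr0 coef1 bin0n mulr0.
- by rewrite exprS mulrBl mul1r coefB coefXM subr0 IH !bin0.
- by rewrite exprS mulrBl mul1r coefB coefXM /= !IH binS natrD exprS; ring.
Qed.

(** This is [exp(-w)] as the limit of [(1 - w / (j + 1)) ^ (j + 1)]. *)
Lemma hyperbolic_exp : hyperbolic (fun n => (-1) ^+ n / n`!%:R).
Proof.
apply: (@hyperbolic_lim (fun j n => (j.+1%:R^-1) ^+ n * (lin_factor (1 : R) ^+ j.+1)`_n)).
  by move=> j; apply: hyperbolic_scale; [rewrite invr_gt0|exact: hyperbolic_pow].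
move=> n; under eq_fun do rewrite coef_lin_factor_exp mulrCA.
apply: cvgM; first exact: cvg_cst.
elim: n => [|n IH].
  by under eq_fun do rewrite bin0 expr0 mulr1; rewrite fact0 invr1; exact: cvg_cst.
have H : (fun j => (j.+1%:R^-1 ^+ n * 'C(j.+1, n)%:R) * (1 - n%:R * j.+1%:R^-1) / n.+1%:R : R) @ \oo
    --> (n`!%:R^-1 * (1 - n%:R * 0) / n.+1%:R : R).
  apply: cvgM; last exact: cvg_cst.
  apply: cvgM; first exact: IH.
  apply: cvgB; first exact: cvg_cst.
  by apply: cvgM; [exact: cvg_cst|exact: cvg_inv_succ].
have -> : (n.+1)`!%:R^-1 = n`!%:R^-1 * (1 - n%:R * 0) / n.+1%:R :> R.
  by rewrite factS natrM invfM mulr0 subr0 mulr1 mulrC.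
(* The quotient of consecutive binomials yields the recurrence; [n <= j] makes its natural-number
   subtraction exact. *)
apply: cvg_trans H; apply: near_eq_cvg; exists n => // j /= nj.
have E := mul_bin_left j.+1 n; have {E} := congr1 (fun m => m%:R : R) E.
rewrite !natrM natrB; last exact: leqW.
move=> E; have -> : 'C(j.+1, n.+1)%:R = (j.+1%:R - n%:R) * 'C(j.+1, n)%:R / n.+1%:R :> R.
  by rewrite -E mulrAC divff ?mul1r.
rewrite exprS; field.
by rewrite !nat1r !pnatr_eq0.
Qed.

(** Passing from [n] to [n + 1] multiplies the expression by [(x + n + M + 1) / ((M + 1) (x + n))],
    which tends to [1 / (x + n)]. *)
Lemma gauss_limit (x : R) n : 0 < x ->
  (fun M => (\prod_(k < M.+1) (1 + n%:R / (x + k%:R))) / M.+1%:R ^+ n) @ \oo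
   --> (rising_factorial x n)^-1.
Proof.
move=> x0; have xk (k : nat) : 0 < x + k%:R by rewrite ltr_wpDr.
elim: n => [|n IH].
  have -> : (rising_factorial x 0)^-1 = 1 by rewrite /rising_factorial big_ord0 invr1.
  have H : (fun=> 1 : R) @ \oo --> (1 : R) by exact: cvg_cst.
  by apply: (cvg_ext _ H) => M; rewrite expr0 divr1 big1 // => i _; rewrite mul0r addr0.
have -> : (rising_factorial x n.+1)^-1 = (rising_factorial x n)^-1 / (x + n%:R).
  by rewrite /rising_factorial big_ord_recr /= invfM.
have H : (fun M => ((\prod_(k < M.+1) (1 + n%:R / (x + k%:R))) / M.+1%:R ^+ n)
     * ((1 + (x + n%:R) * M.+1%:R^-1) / (x + n%:R))) @ \oo
   --> (rising_factorial x n)^-1 * ((1 + (x + n%:R) * 0) / (x + n%:R)).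
  apply: cvgM; first exact: IH.
  apply: cvgM; last exact: cvg_cst.
  apply: cvgD; first exact: cvg_cst.
  by apply: cvgM; [exact: cvg_cst|exact: cvg_inv_succ].
rewrite mulr0 addr0 mul1r in H.
apply: (cvg_ext _ H) => M.
(* The two products differ by the factors [(x + k + n + 1) / (x + k + n)], which telescope. *)
have T : \prod_(k < M.+1) (1 + n.+1%:R / (x + k%:R)) * (x + n%:R) =
   (\prod_(k < M.+1) (1 + n%:R / (x + k%:R))) * (x + n%:R + M.+1%:R).
  elim: M.+1 => [|m IHm]; first by rewrite !big_ord0 addr0.
  rewrite !big_ord_recr /= mulrAC IHm -[m.+1]addn1 -[n.+1]addn1 !natrD.
  by field; rewrite gt_eqF.
have xn := xk n.
have -> : \prod_(k < M.+1) (1 + n.+1%:R / (x + k%:R)) =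
   (\prod_(k < M.+1) (1 + n%:R / (x + k%:R))) * (x + n%:R + M.+1%:R) / (x + n%:R).
  by rewrite -T mulfK // gt_eqF.
rewrite exprS; field.
by rewrite !gt_eqF ?exprn_gt0.
Qed.

(** Each factor of the Gauss product is a multiplier with [b = x + k], and the power of [M + 1] is a
    rescaling of the variable. *)
Lemma hyperbolic_rising_factorial (x : R) a : 0 < x -> hyperbolic a ->
  hyperbolic (fun n => a n / rising_factorial x n).
Proof.
move=> x0 ha; have xk (k : nat) : 0 < x + k%:R by rewrite ltr_wpDr.
have hM M : hyperbolic (fun n => (\prod_(k < M) (1 + n%:R / (x + k%:R))) * a n).
  elim: M => [|M IH].
    by under eq_fun do rewrite big_ord0 mul1r.
  have := hyperbolic_multiplier (xk M) IH.
  congr hyperbolic; apply/funext => n; rewrite big_ord_recr /=; ring.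
apply: (@hyperbolic_lim (fun M n => (M.+1%:R^-1) ^+ n * ((\prod_(k < M.+1) (1 + n%:R / (x + k%:R))) * a n))).
  by move=> M; apply: hyperbolic_scale; rewrite ?invr_gt0.
move=> n; rewrite mulrC.
have H : (fun M => (\prod_(k < M.+1) (1 + n%:R / (x + k%:R))) / M.+1%:R ^+ n * a n) @ \oo
   --> (rising_factorial x n)^-1 * a n.
  by apply: cvgM; [exact: gauss_limit|exact: cvg_cst].
by apply: (cvg_ext _ H) => M; rewrite exprVn; ring.
Qed.

Lemma hyperbolic_hyper_bessel (d : nat) (x : 'I_d -> R) : (forall i, 0 < x i) ->
  hyperbolic (fun n => (-1) ^+ n / (n`!%:R * \prod_(i < d) rising_factorial (x i) n)).
Proof.
move=> x0; have := hyperbolic_exp; set a := (fun n => (-1) ^+ n / _) => ha.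
suff H (s : seq 'I_d) : hyperbolic (fun n => a n / \prod_(i <- s) rising_factorial (x i) n).
  have := H (index_enum 'I_d); congr hyperbolic; apply/funext => n.
  by rewrite /a -mulrA -invfM.
elim: s => [|i s IH]; first by under eq_fun do rewrite big_nil divr1.
have := hyperbolic_rising_factorial (x0 i) IH.
congr hyperbolic; apply/funext => n; rewrite big_cons -mulrA -invfM.
by rewrite [rising_factorial _ _ * _]mulrC.
Qed.

End HyperbolicSequences.

(** * Power sums and the smallest zero *)

Section PowerSums.
Variable R : realType.
Implicit Types (a s : nat -> R) (K : nat).

(** Cauchy-Schwarz: the sum of [x_j ^ (m + 1) (t - x_j)^2] is a nonnegative quadratic in [t],
    evaluated at its minimum [t = B / A]. If [A = 0], all terms vanish. *)
Lemma sum_pow_log_convex K (x : nat -> R) m : (forall j, (j < K)%N -> 0 < x j) ->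
  (\sum_(j < K) x j ^+ m.+2) ^+ 2 <= (\sum_(j < K) x j ^+ m.+1) * \sum_(j < K) x j ^+ m.+3.
Proof.
move=> x0; set A := \sum_(j < K) x j ^+ m.+1; set B := \sum_(_ < _) _; set C := \sum_(_ < _) _.
have H t : 0 <= A * t ^+ 2 - 2 * B * t + C.
  rewrite /A /B /C mulr_sumr !mulr_suml -sumrB -big_split /=; apply: sumr_ge0 => j _.
  rewrite (_ : _ + _ = x j ^+ m.+1 * (t - x j) ^+ 2); last by rewrite [x j ^+ m.+3]exprS [x j ^+ m.+2]exprS; ring.
  by rewrite mulr_ge0 ?sqr_ge0 // exprn_ge0 // ltW // x0.
have A0 : 0 <= A by apply: sumr_ge0 => j _; rewrite exprn_ge0 // ltW // x0.
have [A00|An0] := eqVneq A 0.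
  have xm : forall j : 'I_K, x j ^+ m.+1 = 0.
    move=> j; apply/eqP; move/eqP: A00; rewrite /A psumr_eq0; last first.
      by move=> i _; rewrite exprn_ge0 // ltW // x0.
    by move/allP => /(_ j (mem_index_enum _)).
  by rewrite /B big1 ?expr0n ?A00 ?mul0r // => j _; rewrite exprS xm mulr0.
have A1 : 0 < A by rewrite lt_def An0.
have := H (B / A); rewrite (_ : _ + C = C - B ^+ 2 / A); last by field.
by rewrite subr_ge0 ler_pdivrMr // mulrC.
Qed.

Lemma sum_pow_submul K (x : nat -> R) m n : (forall j, (j < K)%N -> 0 < x j) ->
  \sum_(j < K) x j ^+ (m + n) <= (\sum_(j < K) x j ^+ m) * \sum_(j < K) x j ^+ n.
Proof.
move=> x0; suff H L : (L <= K)%N ->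
    \sum_(j < L) x j ^+ (m + n) <= (\sum_(j < L) x j ^+ m) * \sum_(j < L) x j ^+ n by exact: H.
elim: L => [|L IH] LK; first by rewrite !big_ord0 mul0r.
have xL k : 0 < x L ^+ k by rewrite exprn_gt0 // x0.
have sL k : 0 <= \sum_(j < L) x j ^+ k.
  by apply: sumr_ge0 => j _; rewrite exprn_ge0 // ltW // x0 // (leq_trans (ltn_ord j)) // ltnW.
rewrite !big_ord_recr /= exprD.
have := IH (ltnW LK); have := xL m; have := xL n; have := sL m; have := sL n.
set p := x L ^+ m; set q := x L ^+ n; set A := \sum_(_ < _) _ ^+ m; set B := \sum_(_ < _) _ ^+ n.
move=> B0 A0 q0 p0 /=; have := mulr_ge0 A0 (ltW q0); have := mulr_ge0 (ltW p0) B0.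
rewrite mulrDl !mulrDr; lra.
Qed.

(** The inequalities hold for sums of powers of reciprocal zeros and, not being strict, survive the
    limit. The approximant [p j] matches coefficients up to index [j] within [1 / (j + 1)]. *)
Lemma hyperbolic_psum a : hyperbolic a ->
  [/\ forall m, 0 <= psum a m.+1,
      forall m, psum a m.+2 ^+ 2 <= psum a m.+1 * psum a m.+3
    & forall m n, psum a (m + n).+2 <= psum a m.+1 * psum a n.+1].
Proof.
move=> ha; have inv0 (j : nat) : 0 < j.+1%:R^-1 :> R by rewrite invr_gt0.
have /choice[p Hp] : forall j : nat, exists p, simple_pos_rooted p /\
  forall n, (n <= j)%N -> `|p`_n - a n| < j.+1%:R^-1 by move=> j; exact: ha.
have pa k : (fun j => (p j)`_k) @ \oo --> a k.
  apply/cvgrPdistC_lt => e e0.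
  move/cvgrPdist_lt: (@cvg_inv_succ R) => /(_ _ e0) [J _ HJ].
  exists (maxn J k) => // j /=; rewrite geq_max => /andP[Jj kj].
  have [_ /(_ _ kj) H] := Hp j; apply: lt_trans H _.
  by have := HJ j Jj; rewrite /= sub0r normrN ger0_norm // ltW.
have pc := psum_cvg pa.
have pE j : exists K (x : nat -> R), (forall i, (i < K)%N -> 0 < x i) /\
    forall m, psum (fun n => (p j)`_n) m.+1 = \sum_(i < K) x i ^+ m.+1.
  have [[K [w [w0 _ ->]]] _] := Hp j; exists K, (fun i => (w i)^-1); split.
    by move=> i iK; rewrite invr_gt0 w0.
  by move=> m; rewrite psum_prod_lin.
split.
- move=> m; have c0 : (fun=> 0 : R) @ \oo --> (0 : R) by exact: cvg_cst.
  apply: (ler_cvg_to c0 (pc m.+1)); apply: nearW => j.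
  have [K [x [x0 ->]]] := pE j; apply: sumr_ge0 => i _; by rewrite exprn_ge0 // ltW // x0.
- move=> m; rewrite expr2; apply: (ler_cvg_to (cvgM (pc m.+2) (pc m.+2)) (cvgM (pc m.+1) (pc m.+3))).
  apply: nearW => j; have [K [x [x0 E]]] := pE j.
  by rewrite /= !E -expr2; exact: sum_pow_log_convex.
- move=> m n; apply: (ler_cvg_to (pc _) (cvgM (pc m.+1) (pc n.+1))).
  apply: nearW => j; have [K [x [x0 E]]] := pE j.
  by rewrite /= !E -addSn -addnS; exact: sum_pow_submul.
Qed.

(** Take [r] as the limit of the ratios [s (m + 1) / s m]: log-convexity makes them increase,
    submultiplicativity bounds them by [s 0]. If the first ratio already reaches [r], all ratios
    equal [r]; this clause later yields strictness. *)
Lemma log_convex_growth (s : nat -> R) :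
  (forall m, 0 <= s m) -> (forall m, s m.+1 ^+ 2 <= s m * s m.+2) ->
  (forall m n, s (m + n).+1 <= s m * s n) -> 0 < s 0%N -> 0 < s 1%N ->
  exists r : R, [/\ 0 < r, forall m, s m.+1 <= r * s m, forall m, r ^+ m.+1 <= s m
    & r * s 0%N <= s 1%N -> forall m, s m.+1 = r * s m].
Proof.
move=> s_ge0 lc sub s0 s1.
have sp m : 0 < s m /\ 0 < s m.+1.
  elim: m => // m [IH1 IH2]; split=> //; rewrite lt_def s_ge0 andbT.
  by apply/eqP => E; have := lc m; rewrite E mulr0 leNgt exprn_gt0.
have {}sp m : 0 < s m by case: (sp m).
pose q m := s m.+1 / s m.
have q0 m : 0 < q m by rewrite divr_gt0.
have qmono : nondecreasing_seq q.
  apply/nondecreasing_seqP => m; rewrite /q ler_pdivrMr // mulrAC ler_pdivlMr //.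
  by rewrite -expr2 mulrC lc.
have cq : cvgn q.
  apply: nondecreasing_is_cvgn => //; exists (s 0%N) => _ [m _ <-].
  by rewrite /q ler_pdivrMr // mulrC; have := sub m 0%N; rewrite addn0.
set r := limn q; have qr m : q m <= r by exact: nondecreasing_cvgn_le.
have r0 : 0 < r by apply: lt_le_trans (qr 0%N).
have up m : s m.+1 <= r * s m by rewrite -ler_pdivrMr // qr.
exists r; split => //.
(* Monotone ratios give [s j * q j ^ (m + 1) <= s (j + m + 1) <= s j * s m]; cancel [s j] and let
   [j] grow. *)
- move=> m; have H j : q j ^+ m.+1 <= s m.
    rewrite -(ler_pM2l (sp j)); apply: le_trans (sub j m).
    elim: m => [|m IH]; first by rewrite expr1 addn0 /q mulrCA divff ?mulr1 // gt_eqF.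
    rewrite exprSr mulrA addnS; apply: (@le_trans _ _ (s (j + m).+1 * q j)).
      by rewrite ler_wpM2r // ltW.
    apply: (@le_trans _ _ (s (j + m).+1 * q (j + m).+1)).
      by rewrite ler_wpM2l // qmono // -addnS leq_addr.
    by rewrite /q mulrCA divff ?mulr1 // gt_eqF.
  have cX : (fun j => q j ^+ m.+1) @ \oo --> r ^+ m.+1.
    elim: m.+1 => [|k IHk]; first by under eq_fun do rewrite expr0; exact: cvg_cst.
    by under eq_fun do rewrite exprS; rewrite exprS; exact: cvgM.
  have cs : (fun=> s m) @ \oo --> s m by exact: cvg_cst.
  by apply: (ler_cvg_to cX cs); exact: nearW.
- move=> rs m; apply/eqP; rewrite eq_le up /= -ler_pdivlMr //.
  by apply: le_trans (qmono 0%N m (leq0n _)); rewrite /q ler_pdivlMr.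
Qed.

End PowerSums.

(** * Convergence of the reciprocal series and the zero at [1 / r] *)

Section SmallestZero.
Variable R : realType.
Local Notation C := (Cplx R).
Variable a : nat -> R.
Hypotheses (ea : entire a) (ha : hyperbolic a) (a0 : a 0%N = 1).
Hypotheses (s1 : 0 < psum a 1) (s2 : 0 < psum a 2).

Lemma psum_growth : exists r : R, [/\ 0 < r, forall m, psum a m.+2 <= r * psum a m.+1,
    forall m, r ^+ m.+1 <= psum a m.+1
  & r * psum a 1 <= psum a 2 -> forall m, psum a m.+2 = r * psum a m.+1].
Proof.
have [h1 h2 h3] := hyperbolic_psum ha.
exact: (@log_convex_growth _ (fun m => psum a m.+1)).
Qed.

Lemma psum_ge0 m : 0 <= psum a m.
Proof. by case: m => [|m]; [rewrite psum0|have [] := hyperbolic_psum ha]. Qed.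

Lemma inv_series_ge0 m : 0 <= inv_series a m.
Proof.
have [n] := ubnP m; elim: n m => // n IH [|m] mn; first by rewrite /inv_series /= ler01.
have := congr1 (@^~ m.+1) (euler_inv a0); rewrite /euler /conv big_ord_recl psum0 mul0r add0r.
move=> E; have : 0 <= m.+1%:R * inv_series a m.+1.
  rewrite E; apply: sumr_ge0 => k _; rewrite mulr_ge0 ?psum_ge0 // IH //.
  by rewrite /= /bump /= add1n subSS (leq_ltn_trans (leq_subr _ _)).
by rewrite pmulr_rge0.
Qed.

Variable r : R.
Hypotheses (r0 : 0 < r) (psum_le : forall m, psum a m.+2 <= r * psum a m.+1)
  (psum_ge : forall m, r ^+ m.+1 <= psum a m.+1).

Lemma abscv_psum x : 0 <= x -> x * r < 1 -> abscv (psum a) x.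
Proof.
move=> x0 xr; apply: (@abscv_bounded _ _ x r^-1 (psum a 1 / r)).
  by rewrite x0 -[r^-1]mul1r ltr_pdivlMr.
case=> [|m]; first by rewrite psum0 normr0 mul0r divr_ge0 // ltW.
rewrite ger0_norm ?psum_ge0 // exprVn ler_pdivrMr ?exprn_gt0 //.
rewrite exprS mulrA divfK ?gt_eqF // mulrC.
elim: m => [|m IH]; first by rewrite expr0 mul1r.
by apply: le_trans (psum_le m) _; rewrite exprS -mulrA ler_pM2l.
Qed.

(** At a radius [y] between [x] and [1 / r] the terms [E n] of the reciprocal satisfy
    [n * E n = \sum v k * E (n - k)] with [v] summable, hence stay bounded. *)
Lemma abscv_inv_series x : 0 <= x -> x * r < 1 -> abscv (inv_series a) x.
Proof.
move=> x0 xr; pose y := (x + r^-1) / 2.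
have xr' : x < r^-1 by rewrite -[r^-1]mul1r ltr_pdivlMr.
have xy : x < y by rewrite /y; lra.
have y0 : 0 < y by exact: le_lt_trans xy.
have yr : y * r < 1 by rewrite -ltr_pdivlMr // mul1r /y; lra.
have := abscv_psum (ltW y0) yr; rewrite /abscv; set v := fun n => _ => cv.
have v0 n : 0 <= v n by rewrite /v mulr_ge0 // exprn_ge0 // ltW.
have vle n : series v n <= limn (series v).
  by apply: nondecreasing_cvgn_le => //; apply/nondecreasing_seqP => m; rewrite seriesSr lerDl.
set S := limn (series v) in vle; have S0 : 0 <= S by have := vle 0%N; rewrite /series /= big_geq.
pose E n := inv_series a n * y ^+ n.
have E0 n : 0 <= E n by rewrite mulr_ge0 ?inv_series_ge0 // exprn_ge0 // ltW.
have EE n : n%:R * E n = \sum_(k < n.+1) v k * E (n - k)%N.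
  rewrite mulrA -/(euler (inv_series a) n) euler_inv // /conv mulr_suml.
  apply: eq_bigr => k _; rewrite /v /E ger0_norm ?psum_ge0 // mulrACA -exprD subnKC //.
  by rewrite -ltnS.
(* Once [n] exceeds the total weight [S], dividing the recurrence by [n] preserves the bound [c] on
   earlier terms; [c] covers the initial terms. *)
pose M := (Num.truncn S).+1; pose c := \sum_(k < M.+1) E k.
have c0 : 0 <= c by exact: sumr_ge0.
have SM : S < M%:R by rewrite /M truncnS_gt.
have Ec n : E n <= c.
  have [m] := ubnP n; elim: m n => // m IH n nm.
  case: (ltnP n M.+1) => nM.
    rewrite /c (bigD1 (Ordinal nM)) //= lerDl; exact: sumr_ge0.
  have n0 : 0 < n%:R :> R by rewrite ltr0n (leq_trans _ nM).
  rewrite -(ler_pM2l n0) EE big_ord_recl {1}/v psum0 normr0 !mul0r add0r.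
  apply: (@le_trans _ _ (\sum_(k < n) v k.+1 * c)).
    apply: ler_sum => k _; rewrite /= /bump /= add1n ler_wpM2l // IH //.
    by apply: leq_trans (_ : n <= m)%N => //; rewrite ltn_subrL (leq_trans _ nM).
  rewrite -mulr_suml ler_wpM2r //.
  apply: (@le_trans _ _ S).
    apply: le_trans (vle n.+1); rewrite /series /= big_mkord big_ord_recl.
    by rewrite lerDr.
  by apply: ltW (lt_le_trans SM _); rewrite ler_nat ltnW.
apply: (@abscv_bounded _ _ x y c); first by rewrite x0.
by move=> n; rewrite ger0_norm ?inv_series_ge0 // Ec.
Qed.

Lemma pser_inv_series (z : C) : cmod z * r < 1 -> pser a z * pser (inv_series a) z = 1.
Proof.
move=> zr; rewrite -pserM ?conv_inv //; last 1 first.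
- exact: abscv_inv_series (cmod_ge0 z) zr.
- exact: pser1.
- exact: entire_cmod.
Qed.

Lemma pser_neq0 (z : C) : cmod z * r < 1 -> pser a z != 0.
Proof.
by move/pser_inv_series => E; apply/eqP => az; move/eqP: E; rewrite az mul0r eq_sym oner_eq0.
Qed.

Lemma pser_psum (z : C) : cmod z * r < 1 -> pser (euler a) z = - (pser a z * pser (psum a) z).
Proof.
move=> zr; have cs := abscv_psum (cmod_ge0 z) zr.
rewrite -pserM //; last exact: entire_cmod.
rewrite conv_psum // -mulN1r (_ : -1 = (-1 : R)%:C :> C); last by rewrite rmorphN1.
rewrite -pserZ; first by congr (pser _ z); apply/funext => n; rewrite mulN1r opprK.
under eq_fun do rewrite -mulN1r.
exact/entire_cmod/entireZ/entire_natM.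
Qed.

(** The reciprocal has nonnegative coefficients and constant term 1, so its value at [x] is at least
    1. *)
Lemma pser_real_gt0 (x : R) : 0 <= x -> x * r < 1 ->
  exists2 v : R, 0 < v & pser a x%:C = v%:C.
Proof.
move=> x0 xr; have ci := abscv_inv_series x0 xr.
have := @pser_inv_series x%:C; rewrite cmod_real ger0_norm // => /(_ xr).
rewrite (pser_real x0 ci); set v := limn _ => E.
have v1 : 0 < v.
  apply: (@lt_le_trans _ _ 1) => //.
  have cv : cvgn (series (fun n => inv_series a n * x ^+ n)).
    by have := ci; rewrite /abscv; under eq_fun do rewrite ger0_norm ?inv_series_ge0 //.
  apply: le_trans (nondecreasing_cvgn_le _ cv 1%N); first by rewrite /series /= big_nat1 mulr1.
  by apply/nondecreasing_seqP => m; rewrite seriesSr lerDl mulr_ge0 ?inv_series_ge0 ?exprn_ge0.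
exists v^-1; first by rewrite invr_gt0.
apply: (@mulIf _ (v%:C : C)); first by rewrite (inj_eq (@complexI _) v 0) gt_eqF.
by rewrite E -rmorphM /= mulVf ?gt_eqF.
Qed.

(* With s_m = psum_(m+1) / r^(m+1), nonincreasing and at least 1, the
   convolution of (a_k / r^k) with s equals -(m+1) a_(m+1) / r^(m+1) -> 0, and
   its limit is the value of the series at 1/r times lim s. *)
Lemma pser_zero : pser a (r^-1)%:C = 0.
Proof.
pose s m := psum a m.+1 / r ^+ m.+1.
have s_ge1 m : 1 <= s m by rewrite /s ler_pdivlMr ?exprn_gt0 // mul1r.
have cs : cvgn s.
  apply: nonincreasing_is_cvgn; last by exists 1 => _ [m _ <-].
  apply/nonincreasing_seqP => m; rewrite /s [r ^+ m.+2]exprS invfM mulrA ler_wpM2r //.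
    by rewrite invr_ge0 exprn_ge0 // ltW.
  by rewrite ler_pdivrMr // mulrC.
have l1 : 1 <= limn s by apply: limr_ge => //; exact: nearW.
pose t n : C := (a n)%:C * (r^-1)%:C ^+ n.
have ct : cvgn (series (fun n => cmod (t n))).
  under eq_fun do rewrite cmod_term.
  exact: entire_cmod.
have H := conv_cvg ct (cvg_real_complex cs).
have H0 : conv t (fun n => (s n)%:C) @ \oo --> (0 : C).
  have cE := entire_abscv (ltW (_ : 0 < r^-1)) (entire_natM ea); rewrite invr_gt0 in cE.
  have /cvg_series_cvg_0 c0 := cE r0.
  apply/cvg_cmod; apply: cvg_ext (cvg_succ c0) => n /=.
  have -> : conv t (fun n => (s n)%:C) n = ((- euler a n.+1) * r^-1 ^+ n.+1)%:C.
    rewrite -(congr1 (@^~ n.+1) (conv_psum a0)) /conv [in RHS]big_ord_recr /= subnn psum0 mulr0 addr0.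
    rewrite rmorphM rmorph_sum /= mulr_suml; apply: eq_bigr => k _.
    have kn : (k <= n)%N by rewrite -ltnS.
    rewrite /t /s -rmorphXn -!rmorphM /=; congr (_%:C).
    rewrite -exprVn mulrACA -exprD addnS subnKC // subSn //.
  rewrite sub0r -rmorphN cmod_real normrN mulNr normrN [RHS]normrM; congr (_ * _).
  by rewrite ger0_norm // exprn_ge0 // invr_ge0 ltW.
have /eqP := cvgC_unique H H0; rewrite mulf_eq0 => /orP[/eqP //|].
rewrite (inj_eq (@complexI _) _ 0) => /eqP l0; move: l1; rewrite l0.
by rewrite leNgt ltr01.
Qed.

End SmallestZero.

(** * Strict bounds on the growth rate and positivity of the real part *)

Section ZeroBounds.
Variable R : realType.
Local Notation C := (Cplx R).
Implicit Types (a g h : nat -> R).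

(** The positivity of the first power sum excludes the constant 1, that of the second excludes
    [exp(-w)], which has no zeros. *)
Definition laguerre_series a : Prop :=
  [/\ entire a, hyperbolic a, a 0%N = 1 & 0 < psum a 1 /\ 0 < psum a 2].

(** By Newton's identity, [r^2 <= sigma_2 = sigma_1^2 - 2 a_2 < sigma_1^2]. *)
Lemma growth_lt_psum1 a (r : R) : a 0%N = 1 -> 0 < psum a 1 -> 0 < a 2%N ->
  (forall m, r ^+ m.+1 <= psum a m.+1) -> 0 < r -> r < psum a 1.
Proof.
move=> a0 s1 a2 rge r0; rewrite -(@ltr_pXn2r _ 2) ?nnegrE ?ltW //.
apply: le_lt_trans (rge 1%N) _; rewrite psum2 psum1 sqrrN; lra.
Qed.

(** Otherwise the power sums are geometric, and Newton's identities become [(n + 2) a_(n+2) = (r (n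
    + 1) - sigma_1) a_(n+1)]. Alternating signs then force [r (n + 1) < sigma_1] for every [n],
    which is absurd. *)
Lemma psum_ratio_lt_growth a (r : R) : a 0%N = 1 -> (forall n, 0 < (-1) ^+ n * a n) -> 0 < r ->
  (r * psum a 1 <= psum a 2 -> forall m, psum a m.+2 = r * psum a m.+1) ->
  psum a 2 < r * psum a 1.
Proof.
move=> a0 alt r0 req; rewrite ltNge; apply/negP => /req {}req.
have N n : \sum_(k < n.+1) a k * psum a (n - k).+1 = - (n.+1%:R * a n.+1).
  have := congr1 (@^~ n.+1) (conv_psum a0); rewrite /conv big_ord_recr /= subnn psum0 mulr0 addr0.
  by rewrite /euler => <-; apply: eq_bigr => k _; rewrite subSn // -ltnS.
have rec n : n.+2%:R * a n.+2 = (r * n.+1%:R - psum a 1) * a n.+1.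
  have := N n.+1; rewrite big_ord_recr /= subnn.
  rewrite (eq_bigr (fun k : 'I_n.+1 => r * (a k * psum a (n - k).+1))) => [|k _].
    by rewrite -mulr_sumr N => E; lra.
  have kn : (k <= n)%N by rewrite -ltnS.
  by rewrite subSn // req mulrCA.
have H n : r * n.+1%:R < psum a 1.
  have p2 := alt n.+1; have := mulr_gt0 (ltr0Sn R n.+1) (alt n.+2).
  rewrite mulrCA rec [(-1) ^+ n.+2]exprS mulN1r => p1.
  by rewrite -subr_gt0 -(pmulr_lgt0 _ p2); move: p1; lra.
have := H (Num.truncn (psum a 1 / r)); rewrite mulrC -ltr_pdivlMr //.
by rewrite ltNge ltW // truncnS_gt.
Qed.

(** For the zero [1 / r] these are the strict Euler-Rayleigh bounds
    [1 / sigma_1 < 1 / r < sigma_1 / sigma_2]. *)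
Lemma smallest_zero_bounds a : laguerre_series a -> (forall n, 0 < (-1) ^+ n * a n) ->
  exists r : R, [/\ 0 < r, r < psum a 1, psum a 2 < r * psum a 1,
    forall m, psum a m.+2 <= r * psum a m.+1 & forall m, r ^+ m.+1 <= psum a m.+1].
Proof.
move=> [ea ha a0 [s1 s2]] alt; have [r [r0 le ge eq]] := psum_growth ha s1 s2.
exists r; split=> //; last exact: psum_ratio_lt_growth.
by apply: growth_lt_psum1 => //; have := alt 2%N; rewrite sqrrN expr1n mul1r.
Qed.

(** Here [h = g + D w g'], so [h / g = 1 - D \sum sigma_m w^m], where the [sigma_m] are the power
    sums of [g]. Nonnegativity of the [sigma_m] reduces the claim to the point [|w|]. *)
Lemma laguerre_Re_gt0 g h (D rg rh : R) (w : C) : 2 <= D ->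
  laguerre_series g -> laguerre_series h ->
  (forall n, h n = (1 + D * n%:R) * g n) ->
  0 < rg -> (forall m, psum g m.+2 <= rg * psum g m.+1) -> (forall m, rg ^+ m.+1 <= psum g m.+1) ->
  0 < rh -> (forall m, psum h m.+2 <= rh * psum h m.+1) ->
  cmod w * rh < 1 ->
  pser g w != 0 /\ 0 < complex.Re (pser h w / pser g w).
Proof.
move=> D2 [eg hg g0 [g1 g2]] [eh hh h0 [h1 h2]] hgE rg0 gle gge rh0 hle wr.
have hE (z : C) : cmod z * rg < 1 -> pser h z = pser g z * (1 - D%:C * pser (psum g) z).
  move=> zr; have -> : h = fun n => g n + D * euler g n.
    by apply/funext => n; rewrite hgE /euler; ring.
  rewrite pserD ?pserZ; first by rewrite (pser_psum eg hg g0 g1 rg0 gle zr); ring.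
  - by apply: entire_cmod; exact: entire_natM.
  - exact: entire_cmod.
  - by apply: entire_cmod; apply: entireZ; exact: entire_natM.
(* At such real points both [g] and [h] are positive, hence so is their quotient [1 - D S]. *)
have S_lt (x : R) : 0 <= x -> x * rg < 1 -> x * rh < 1 ->
    D * limn (series (fun n => psum g n * x ^+ n)) < 1.
  move=> x0 xg xh; have cs := abscv_psum hg g1 rg0 gle x0 xg.
  have [vg vg0 Eg] := pser_real_gt0 eg hg g0 g1 rg0 gle x0 xg.
  have [vh vh0 Eh] := pser_real_gt0 eh hh h0 h1 rh0 hle x0 xh.
  have := hE x%:C; rewrite cmod_real ger0_norm // => /(_ xg).
  rewrite Eg Eh (pser_real x0 cs) => /(congr1 (@complex.Re R)).
  set S := limn _; rewrite /= ?mul0r ?mulr0 ?subr0 => E.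
  rewrite -subr_gt0 -(pmulr_rgt0 _ vg0).
  by have := vh0; rewrite E.
(* Otherwise [S_lt] applies at [x = 1 / (2 rg)], where [sigma_1 x >= rg x = 1 / 2]; with [D >= 2]
   this contradicts [D S < 1]. *)
have rgh : rg < rh.
  rewrite ltNge; apply/negP => rhg; pose x := (2 * rg)^-1.
  have x0 : 0 < x by rewrite invr_gt0 mulr_gt0.
  have xg2 : x * rg = 2^-1 by rewrite /x; field; rewrite gt_eqF.
  have xg : x * rg < 1 by rewrite xg2; lra.
  have xh : x * rh < 1 by apply: le_lt_trans xg; rewrite ler_pM2l.
  have := S_lt x (ltW x0) xg xh; set S := limn _; apply/negP; rewrite -leNgt.
  have S2 : 2^-1 <= S.
    have cs := abscv_psum hg g1 rg0 gle (ltW x0) xg.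
    have cv : cvgn (series (fun n => psum g n * x ^+ n)).
      by have := cs; rewrite /abscv; under eq_fun do rewrite (ger0_norm (psum_ge0 hg _)).
    apply: le_trans (nondecreasing_cvgn_le _ cv 2%N).
      rewrite /series /= big_nat_recr //= big_nat1 psum0 mul0r add0r expr1 -xg2 mulrC ler_pM2r //.
      by have := gge 0%N; rewrite expr1.
    by apply/nondecreasing_seqP => m; rewrite seriesSr lerDl mulr_ge0 ?psum_ge0 ?exprn_ge0 // ltW.
  apply: (@le_trans _ _ (2 * 2^-1)); first by rewrite mulfV.
  by apply: ler_pM => //; rewrite ?invr_ge0.
have wg : cmod w * rg < 1.
  by apply: le_lt_trans wr; rewrite ler_wpM2l ?cmod_ge0 // ltW.
have gn0 := pser_neq0 eg hg g0 g1 rg0 gle wg; split=> //.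
rewrite (hE _ wg) mulrAC divff // mul1r.
have cs := abscv_psum hg g1 rg0 gle (cmod_ge0 w) wg.
have := S_lt _ (cmod_ge0 w) wg wr; have := cmod_pser cs.
rewrite (_ : (fun n => `|psum g n| * _) = (fun n => psum g n * cmod w ^+ n)); last first.
  by apply/funext => n; rewrite ger0_norm // psum_ge0.
set S := limn _ => H1 H2; have := le_trans (ler_norm _) (le_trans (Re_le_cmod (pser (psum g) w)) H1).
case: (pser (psum g) w) => x y /= xS; rewrite !mul0r subr0.
have : D * x <= D * S by rewrite ler_wpM2l // (le_trans _ D2).
lra.
Qed.

End ZeroBounds.

(** * The hyper-Bessel series *)

Lemma entire_unshift (R : realType) (a : nat -> R) : entire (fun n => a n.+1) -> entire a.
Proof.
move=> ea y y0; have [K HK] := ea y y0; exists (`|a 0%N| + K * y) => -[|n].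
  rewrite expr0 mulr1 lerDl mulr_ge0 //; apply: le_trans (HK 0%N); by rewrite mulr_ge0.
rewrite exprSr mulrA; apply: (@le_trans _ _ (K * y)); last by rewrite lerDr.
exact: ler_wpM2r.
Qed.

Section HyperBessel.
Variables (R : realType) (d : nat) (alpha : 'I_d -> R).
Hypotheses (halpha : forall i, -1 < alpha i).
Local Notation C := (Cplx R).
Local Notation D := d.+1.
Implicit Types (z : C) (n : nat).

Definition hb_coef n : R :=
  (-1) ^+ n / (n`!%:R * \prod_(i < d) rising_factorial (alpha i + 1) n).

(** [1 + D n] is the eigenvalue of [1 + z d/dz] on [z^(D n)]: [k = 1] gives [f'], and [k = 2] gives
    [(z f')']. *)
Definition hb_coef_mul (k : nat) n : R := (1 + D%:R * n%:R) ^+ k * hb_coef n.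

Definition hb_arg z : C := ((D%:R^-1 : R)%:C * z) ^+ D.

Let alpha1_gt0 i : 0 < alpha i + 1.
Proof. by have := halpha i; lra. Qed.

Lemma rising_factorial_gt0 (x : R) n : 0 < x -> 0 < rising_factorial x n.
Proof. by move=> x0; apply: prodr_gt0 => k _; rewrite ltr_wpDr. Qed.

Lemma rising_factorial_ge (x : R) n : 0 < x -> x <= rising_factorial x n.+1.
Proof.
move=> x0; elim: n => [|n IH]; first by rewrite /rising_factorial big_ord1 addr0.
rewrite /rising_factorial big_ord_recr -/(rising_factorial x n.+1) /=.
apply: le_trans IH _; rewrite ler_peMr ?(ltW (rising_factorial_gt0 _ _)) //.
by apply: le_trans (_ : n.+1%:R <= _); rewrite ?ler1n // lerDr ltW.
Qed.

Let den_gt0 n : 0 < n`!%:R * \prod_(i < d) rising_factorial (alpha i + 1) n :> R.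
Proof.
by rewrite mulr_gt0 ?ltr0n ?fact_gt0 // prodr_gt0 // => i _; apply: rising_factorial_gt0.
Qed.

Lemma prodA_gt0 : 0 < prodA alpha.
Proof. exact: prodr_gt0. Qed.

Lemma prodA_le_prodB : prodA alpha <= prodB alpha.
Proof.
by apply: ler_prod => i _; rewrite ltW //= lerD2l ler1n.
Qed.

Lemma hb_coef_mul_alt k n : 0 < (-1) ^+ n * hb_coef_mul k n.
Proof.
rewrite /hb_coef_mul mulrCA; apply: mulr_gt0.
  by rewrite exprn_gt0 // ltr_wpDr // mulr_ge0.
by rewrite /hb_coef mulrA -expr2 sqrr_sign mul1r invr_gt0.
Qed.

Lemma entire_hb_coef : entire hb_coef.
Proof.
move=> y y0; have [K HK] : exists K : R, forall n, y ^+ n / n`!%:R <= K.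
  have ce := @is_cvg_series_exp_coeff R y.
  exists (limn (series (exp_coeff y))) => n.
  have e0 m : 0 <= exp_coeff y m by rewrite /exp_coeff /= divr_ge0 // exprn_ge0.
  apply: le_trans (nondecreasing_cvgn_le _ ce n.+1).
    by rewrite seriesSr lerDr /series /=; apply: sumr_ge0 => i _.
  by apply/nondecreasing_seqP => m; rewrite seriesSr lerDl.
have A0 := prodA_gt0.
(* The rising factorials multiply to at least [prodA alpha] for [n > 0]; the summand 1 covers
   [n = 0], where they equal 1. *)
exists ((1 + (prodA alpha)^-1) * K) => n.
rewrite /hb_coef normrM normrX normrN1 expr1n mul1r gtr0_norm ?invr_gt0 //.
rewrite invfM mulrAC mulrC [n`!%:R^-1 * _]mulrC; apply: ler_pM => //.
- by rewrite invr_ge0 ltW // prodr_gt0 // => i _; apply: rising_factorial_gt0.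
- by rewrite divr_ge0 // exprn_ge0.
- case: n => [|n].
    rewrite big1; first by rewrite invr1 lerDl invr_ge0 ltW.
    by move=> i _; rewrite /rising_factorial big_ord0.
  apply: (@le_trans _ _ (prodA alpha)^-1); last by rewrite lerDr.
  rewrite lef_pV2 ?posrE //; last by rewrite prodr_gt0 // => i _; apply: rising_factorial_gt0.
  by apply: ler_prod => i _; rewrite ltW //= rising_factorial_ge.
Qed.

Lemma hb_coef_mulS k n : hb_coef_mul k.+1 n = hb_coef_mul k n + D%:R * (n%:R * hb_coef_mul k n).
Proof. by rewrite /hb_coef_mul exprS; ring. Qed.

Lemma entire_hb_coef_mul k : entire (hb_coef_mul k).
Proof.
elim: k => [|k IH]; first by under [hb_coef_mul 0]funext do rewrite /hb_coef_mul expr0 mul1r; exact: entire_hb_coef.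
rewrite (_ : hb_coef_mul k.+1 = fun n => hb_coef_mul k n + D%:R * (n%:R * hb_coef_mul k n)).
  by apply: entireD => //; apply: entireZ; exact: entire_natM.
by apply/funext => n; exact: hb_coef_mulS.
Qed.

Lemma hyperbolic_hb_coef_mul k : hyperbolic (hb_coef_mul k).
Proof.
elim: k => [|k IH].
  rewrite (_ : hb_coef_mul 0 = hb_coef); first exact: hyperbolic_hyper_bessel.
  by apply/funext => n; rewrite /hb_coef_mul mul1r.
(* [1 + D n] is the multiplier [1 + n / b] for [b = 1 / D]. *)
have := @hyperbolic_multiplier _ (D%:R^-1) _ _ IH; rewrite invr_gt0 ltr0n => /(_ isT).
congr hyperbolic; apply/funext => n.
by rewrite /hb_coef_mul invrK exprS mulrA [D%:R * _]mulrC.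
Qed.

Lemma hb_coef_mul0 k : hb_coef_mul k 0 = 1.
Proof.
rewrite /hb_coef_mul mulr0 addr0 expr1n mul1r /hb_coef fact0 big1 ?mulr1 ?invr1 ?mulr1 //.
by move=> i _; rewrite /rising_factorial big_ord0.
Qed.

Lemma psum1_hb k : psum (hb_coef_mul k) 1 = d.+2%:R ^+ k / prodA alpha.
Proof.
rewrite psum1 /hb_coef_mul mulr1 nat1r /hb_coef mul1r expr1 mulN1r mulrN opprK.
congr (_ / _); apply: eq_bigr => i _; by rewrite /rising_factorial big_ord1 addr0.
Qed.

Lemma psum2_hb k : psum (hb_coef_mul k) 2 =
  (d.+2%:R ^+ (2 * k) * prodB alpha - (2 * d + 3)%:R ^+ k * prodA alpha)
   / (prodA alpha ^+ 2 * prodB alpha).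
Proof.
have A0 := prodA_gt0; have B0 := lt_le_trans A0 prodA_le_prodB.
have := psum1_hb k; rewrite psum1 => E1; rewrite psum2 -[_ ^+ 2]sqrrN E1.
have -> : hb_coef_mul k 2 = (2 * d + 3)%:R ^+ k / (2 * (prodA alpha * prodB alpha)).
  rewrite /hb_coef_mul /hb_coef sqrrN expr1n mul1r; congr (_ ^+ k / (_ * _)).
    by rewrite -natrM nat1r; congr (_%:R); lia.
  rewrite /prodA /prodB -big_split; apply: eq_bigr => i _ /=.
  by rewrite /rising_factorial !big_ord_recr big_ord0 /= mul1r addr0 -addrA.
rewrite [(2 * k)%N]mulnC exprM; field.
by rewrite !gt_eqF.
Qed.

(** Both [(d + 2)^2 > 2 d + 3] and [prodA alpha <= prodB alpha] enter; for [k = 2] this is the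
    positivity of the denominator in the upper bound. *)
Lemma psum2_hb_gt0 k : (0 < k)%N -> 0 < psum (hb_coef_mul k) 2.
Proof.
move=> k0; have A0 := prodA_gt0; have AB := prodA_le_prodB; have B0 := lt_le_trans A0 AB.
rewrite psum2_hb divr_gt0 ?mulr_gt0 ?exprn_gt0 // subr_gt0.
apply: (@lt_le_trans _ _ (d.+2%:R ^+ (2 * k) * prodA alpha)); last by rewrite ler_pM2l ?exprn_gt0.
rewrite ltr_pM2r // exprM ltrXn2r ?nnegrE -?lt0n //.
  by rewrite -natrX ltr_nat; nia.
Qed.

Lemma laguerre_hb k : (0 < k)%N -> laguerre_series (hb_coef_mul k).
Proof.
move=> k0; split; [exact: entire_hb_coef_mul|exact: hyperbolic_hb_coef_mul|exact: hb_coef_mul0|].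
by split; [rewrite psum1_hb divr_gt0 ?exprn_gt0 ?prodA_gt0|exact: psum2_hb_gt0].
Qed.

(** * Derivatives in [z] as series in [w = hb_arg z] *)

Let A_ := spread D D%:R^-1 hb_coef.

Lemma hyper_bessel_pser : hyper_bessel alpha = pser A_.
Proof.
apply/funext => z; rewrite /A_ pser_spread //; last exact: entire_hb_coef.
have -> : (D%:R^-1 : R)%:C * z = z / D%:R by rewrite fmorphV rmorph_nat mulrC.
rewrite /hyper_bessel /pser; congr (limn (series _)); apply/funext => n.
by rewrite -exprM mulnC.
Qed.

(** Differentiation in [z] multiplies coefficients by a polynomial [q] in the exponent, and only
    exponents [D n] occur. *)
Lemma pser_spread_hb (q : nat -> R) (k : nat) z : (forall n, q (D * n)%N = (1 + D%:R * n%:R) ^+ k) ->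
  pser (fun n => q n * A_ n) z = pser (hb_coef_mul k) (hb_arg z).
Proof.
move=> qE; rewrite /A_ (@spread_mul R D D%:R^-1 hb_coef q (ltn0Sn d)).
have -> : (fun n => q (D * n)%N * hb_coef n) = hb_coef_mul k by apply/funext => n; rewrite qE.
by rewrite pser_spread //; exact: entire_hb_coef_mul.
Qed.

Let eA : entire A_ := entire_spread D D%:R^-1 entire_hb_coef.

Lemma pser_mulz (a b : nat -> R) z : entire a -> b 0%N = 0 -> (forall n, b n.+1 = a n) ->
  z * pser a z = pser b z.
Proof.
move=> ea b0 bE; have E : (fun n => b n.+1) = a by apply/funext.
by rewrite (pser_shift (a := b)) E ?b0 ?add0r //; exact: entire_cmod.
Qed.

Lemma derive1_hyper_bessel_f z :
  derive1 (hyper_bessel_f alpha) z = pser (hb_coef_mul 1) (hb_arg z).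
Proof.
pose b n := if n is m.+1 then A_ m else 0.
have -> : hyper_bessel_f alpha = pser b.
  by apply/funext => y; rewrite /hyper_bessel_f hyper_bessel_pser; exact: pser_mulz.
rewrite derive1_pser.
  apply: (pser_spread_hb (q := fun n => n.+1%:R)) => n.
  by rewrite expr1 -natrM nat1r.
by apply: entire_unshift; exact: eA.
Qed.

(** On coefficients, [n (n + 1) = (n + 1)^2 - (n + 1)]. *)
Lemma derive2_hyper_bessel_f z : z * derive1 (derive1 (hyper_bessel_f alpha)) z =
  pser (hb_coef_mul 2) (hb_arg z) - pser (hb_coef_mul 1) (hb_arg z).
Proof.
have e1 : entire (fun n => n.+1%:R * A_ n).
  have := entireD eA (entire_natM eA); congr entire; apply/funext => n.
  by rewrite -[n.+1]addn1 natrD; ring.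
have E y : pser (fun n => n.+1%:R * A_ n) y = pser (hb_coef_mul 1) (hb_arg y).
  by apply: (pser_spread_hb (q := fun n => n.+1%:R)) => n; rewrite expr1 -natrM nat1r.
have -> : derive1 (hyper_bessel_f alpha) = pser (fun n => n.+1%:R * A_ n).
  by apply/funext => y; rewrite derive1_hyper_bessel_f E.
rewrite derive1_pser // (pser_mulz (b := fun n => n%:R * (n.+1%:R * A_ n))) //.
- have -> : pser (hb_coef_mul 2) (hb_arg z) = pser (fun n => n.+1%:R ^+ 2 * A_ n) z.
    apply/esym/(pser_spread_hb (q := fun n => n.+1%:R ^+ 2)) => n.
    by rewrite -natrM nat1r.
  rewrite -E; apply/eqP; rewrite eq_sym subr_eq eq_sym -pserD; last 2 first.
  + exact/entire_cmod/entire_natM.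
  + exact: entire_cmod.
  apply/eqP; congr (pser _ z); apply/funext => n.
  by rewrite -[n.+1]addn1 natrD; ring.
- exact: entire_diffs.
- by rewrite mul0r.
Qed.

(** On coefficients, [1 + 3 n + n (n - 1) = (n + 1)^2], so the equation is [(z f')' = 0]. *)
Lemma hyper_bessel_equation z :
  hyper_bessel alpha z + 3%:R * z * derive1 (hyper_bessel alpha) z
    + z ^+ 2 * derive1 (derive1 (hyper_bessel alpha)) z = pser (hb_coef_mul 2) (hb_arg z).
Proof.
have -> : derive1 (hyper_bessel alpha) = pser (diffs A_).
  by apply/funext => y; rewrite hyper_bessel_pser derive1_pser.
rewrite hyper_bessel_pser derive1_pser; last exact: entire_diffs.
have e1 := entire_natM eA.
have E1 : z * pser (diffs A_) z = pser (fun n => n%:R * A_ n) z.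
  by apply: pser_mulz; rewrite ?mul0r //; exact: entire_diffs.
pose b n := n%:R * (n%:R - 1) * A_ n.
have eb : entire b.
  have := entireD (entire_natM e1) (entireZ (-1) e1); congr entire; apply/funext => n.
  by rewrite /b; ring.
have E2 : z ^+ 2 * pser (diffs (diffs A_)) z = pser b z.
  rewrite expr2 -mulrA (pser_mulz (b := fun n => n%:R * diffs A_ n)) ?mul0r //; last first.
    by do 2 apply: entire_diffs.
  apply: pser_mulz; rewrite /b ?mul0r //; first exact/entire_natM/entire_diffs.
  by move=> n; rewrite /diffs -[n.+1]addn1 natrD; ring.
rewrite -mulrA E1 E2 (_ : 3%:R = (3%:R : R)%:C :> C); last by rewrite rmorph_nat.
rewrite -pserZ; last exact: entire_cmod.
rewrite -!pserD; try (apply: entire_cmod; by [|exact: entireZ|apply: entireD => //; exact: entireZ]).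
rewrite -(pser_spread_hb (q := fun n => n.+1%:R ^+ 2)) => [|n]; last by rewrite -natrM nat1r.
congr (pser _ z); apply/funext => n; rewrite /b -[n.+1]addn1 natrD; ring.
Qed.

Lemma cmod_hb_arg z : cmod (hb_arg z) = (cmod z / D%:R) ^+ D.
Proof.
by rewrite /hb_arg cmodX cmodM cmod_real ger0_norm ?invr_ge0 // mulrC.
Qed.

Lemma hb_arg_real (t : R) : hb_arg (D%:R * t)%:C = (t ^+ D)%:C.
Proof.
by rewrite /hb_arg -rmorphM -rmorphXn /= mulKf ?pnatr_eq0.
Qed.

End HyperBessel.

(** * The radius of convexity in the variable [z] *)

Lemma exists_root (R : realType) (n : nat) (y : R) : 0 < y -> exists2 t : R, 0 < t & t ^+ n.+1 = y.
Proof.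
move=> y0; have y1 : 0 <= 1 + y by rewrite addr_ge0 // ltW.
have E (x : R) : ('X^(n.+1) - y%:P : {poly R}).[x] = x ^+ n.+1 - y by rewrite hornerD hornerN hornerXn hornerC.
(* The sign changes on this interval because [(1 + y) ^ (n + 1) >= 1 + y > y]. *)
have [|t] := @polyrcf.poly_ivtoo R ('X^(n.+1) - y%:P) 0 (1 + y) y1.
  rewrite !E expr0n /= sub0r mulNr oppr_lt0 mulr_gt0 // subr_gt0.
  apply: (@lt_le_trans _ _ (1 + y)); first by rewrite ltrDr.
  by rewrite exprS ler_peMr // exprn_ege1 // lerDl ltW.
rewrite in_itv /= => /andP[t0 _] /rootP; rewrite E => /eqP; rewrite subr_eq0 => /eqP.
by exists t.
Qed.

Unset Implicit Arguments.

Theorem theorem2 (R : realType) (d : nat) (hd : (1 <= d)%N)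
    (alpha : 'I_d -> R) (halpha : forall i : 'I_d, -1 < alpha i) :
  exists r : R,
    [/\ radius_of_convexity (hyper_bessel_f alpha) = r%:E,
        is_smallest_positive_root
          (fun z : Cplx R => hyper_bessel alpha z
                     + 3%:R * z * derive1 (hyper_bessel alpha) z
                     + z ^+ 2 * derive1 (derive1 (hyper_bessel alpha)) z) r,
        (d + 1)%:R ^+ (d + 1) * prodA alpha / (d + 2)%:R ^+ 2 < r ^+ (d + 1)
      & r ^+ (d + 1) <
        (d + 1)%:R ^+ (d + 1) * (d + 2)%:R ^+ 2 * prodA alpha * prodB alpha
        / ((d + 2)%:R ^+ 4 * prodB alpha
           - (2 * d + 3)%:R ^+ 2 * prodA alpha)].
Proof.
have Lg := laguerre_hb halpha (isT : 0 < 1)%N; have Lh := laguerre_hb halpha (isT : 0 < 2)%N.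
have A0 := prodA_gt0 halpha; have B0 := lt_le_trans A0 (prodA_le_prodB halpha).
(* In the variable [w], [1 / rg] and [1 / rh] are the smallest positive zeros of [f'] and of
   [(z f')']. *)
have [rg [rg0 _ _ gle gge]] := smallest_zero_bounds Lg (hb_coef_mul_alt halpha 1).
have [rh [rh0 rh1 rh2 hle hge]] := smallest_zero_bounds Lh (hb_coef_mul_alt halpha 2).
have [eh hh h0 [hs1 hs2]] := Lh.
have [t t0 tE] : exists2 t : R, 0 < t & t ^+ d.+1 = rh^-1 by apply: exists_root; rewrite invr_gt0.
(* Chosen so that [hb_arg] sends [r] to the zero [1 / rh]. *)
pose r := d.+1%:R * t; have r0 : 0 < r by rewrite mulr_gt0.
have arg_lt (z : Cplx R) : cmod z < r -> cmod (hb_arg d z) * rh < 1.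
  move=> zr; rewrite cmod_hb_arg -ltr_pdivlMr // mul1r -tE ltrXn2r ?nnegrE ?divr_ge0 ?cmod_ge0 ?(ltW t0) //.
  by rewrite ltr_pdivrMr // mulrC.
have zero : pser (hb_coef_mul alpha 2) (hb_arg d r%:C) = 0.
  by rewrite hb_arg_real tE; exact: pser_zero.
have convE (z : Cplx R) : pser (hb_coef_mul alpha 1) (hb_arg d z) != 0 ->
    1 + z * derive1 (derive1 (hyper_bessel_f alpha)) z / derive1 (hyper_bessel_f alpha) z =
    pser (hb_coef_mul alpha 2) (hb_arg d z) / pser (hb_coef_mul alpha 1) (hb_arg d z).
  move=> gn0; rewrite derive2_hyper_bessel_f // derive1_hyper_bessel_f //.
  by rewrite mulrBl divff // addrC subrK.
have sup : [set x : R | 0 < x /\ convex_on_disk (hyper_bessel_f alpha) x] r.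
  split=> // z; rewrite cmodE ltcR => /arg_lt zr.
  have [] := @laguerre_Re_gt0 R _ _ d.+1%:R rg rh (hb_arg d z) _ Lg Lh _ rg0 gle gge rh0 hle zr.
  - by rewrite ler_nat.
  - by move=> n; rewrite /hb_coef_mul expr2 mulrA.
  by move=> gn0 Re; split; [rewrite derive1_hyper_bessel_f|rewrite convE].
exists r; split.
- apply/le_anti/andP; split; last by apply: ereal_sup_ubound; exists r.
  (* A disk of larger radius contains the point [r], where the quotient is 0 and its real part is
     not positive. *)
  apply: ub_ereal_sup => _ [x [x0 cx] <-]; rewrite lee_fin leNgt; apply/negP => rx.
  have rx' : `|r%:C : Cplx R| < x%:C by rewrite cmodE cmod_real ltcR gtr0_norm.
  have [gn0] := cx _ rx'.
  rewrite derive1_hyper_bessel_f // in gn0.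
  by rewrite convE // zero mul0r ltxx.
- split=> //; first by rewrite hyper_bessel_equation.
  move=> s s0; rewrite hyper_bessel_equation // => /eqP hs; rewrite leNgt; apply/negP => sr.
  (* A smaller root would map to a zero of modulus below [1 / rh], where the reciprocal series
     converges. *)
  suff : pser (hb_coef_mul alpha 2) (hb_arg d s%:C) != 0 by rewrite hs.
  by apply: (pser_neq0 eh hh h0 hs1 rh0 hle); apply: arg_lt; rewrite cmod_real gtr0_norm.
- rewrite !addn1 addn2 /r exprMn tE -mulrA ltr_pM2l ?exprn_gt0 //.
  (* This is [rh < sigma_1 = (d + 2)^2 / A] inverted. *)
  by rewrite -[X in X < _]invf_div -(psum1_hb alpha) ltf_pV2 ?posrE.
- have E (p q u v w : R) : p * q * u * v / w = p * (q * u * v / w) by rewrite !mulrA.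
  rewrite !addn1 addn2 /r exprMn tE E ltr_pM2l ?exprn_gt0 //.
  have AB0 : 0 < prodA alpha ^+ 2 * prodB alpha by rewrite mulr_gt0 ?exprn_gt0.
  (* The bound is [sigma_2 < rh * sigma_1] cleared of denominators; [X] is the denominator in the
     statement, positive because [sigma_2] is. *)
  move: hs2 rh2; rewrite psum1_hb psum2_hb //; set X := _ - _ => hs2.
  have X0 : 0 < X by move: hs2; rewrite pmulr_lgt0 // invr_gt0.
  rewrite ltr_pdivrMr // => rh2; rewrite -div1r ltr_pdivrMr // mulrAC ltr_pdivlMr // mul1r.
  rewrite (_ : _ * rh = rh * (d.+2%:R ^+ 2 / prodA alpha) * (prodA alpha ^+ 2 * prodB alpha)) //.
  by field; rewrite gt_eqF.
Qed.
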